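(* The following identities of formal power series hold. (1) If $a_n$ is the number of maximally clustered permutations in $S_{n}$, then $$\sum_{n\ge 0}a_{n+1}x^n=\frac{2x}{-1+4x-2x^2+\sqrt{1-4x}} .$$ (2) If $b_n$ is the number of freely-braided hexagon-avoiding permutations in $S_n$, then $$\sum_{n\ge 0}b_{n+1}x^n=\frac{-x^6-2x^5+2x^4+x^3-3x^2+4x-1}{x^7-x^6-8x^5+x^4+3x^3-9x^2+6x-1} .$$ (3) If $m_n$ is the number of maximally-clustered hexagon-avoiding permutations in $S_n$, then $$\sum_{n\ge 0}m_{n+1}x^n=\frac{3x^5+x^4-5x^3+7x^2-5x+1}{-3x^6+4x^5+8x^4-14x^3+15x^2-7x+1} .$$
   Context: All avoidance is classical (one-line notation) permutation pattern avoidance. A permutation is freely braided if it avoids $[4231],[3421],[4312],[4321]$; it is maximally clustered if it avoids $[3421],[4312],[4321]$. Hexagon-avoiding permutations are those avoiding $[46718235],[46781235],[56718234],[56781234]$. ''Freely-braided hexagon-avoiding'' (respectively ''maximally-clustered hexagon-avoiding'') means avoiding all patterns of both lists. Here $\sqrt{1-4x}$ is the formal power series with constant term $1$ whose square is $1-4x$, and quotients are taken in the field of formal Laurent series. *)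

(* Defs.v *)
From HB Require Import structures.
From mathcomp Require Import all_boot all_order all_fingroup all_algebra.
From mathcomp Require Import boolp classical_sets.

Set Implicit Arguments.
Unset Strict Implicit.
Unset Printing Implicit Defensive.

Import Order.TTheory GRing.Theory Num.Theory.

Local Open Scope ring_scope.

(* A pattern is given in one-line notation with values 1, ..., k.  The one-line
   notation of w : 'S_n is w 0, ..., w (n - 1), with values shifted by one; only
   relative order matters.  The map f lists the positions of an occurrence. *)
Definition contains (n : nat) (w : 'S_n) (p : seq nat) : bool :=
  [exists f : {ffun 'I_(size p) -> 'I_n},
    [forall i : 'I_(size p), forall j : 'I_(size p),
       (i < j)%N ==> (f i < f j)%N] &&
    [forall i : 'I_(size p), forall j : 'I_(size p),
       (w (f i) < w (f j))%N == (nth 0%N p i < nth 0%N p j)%N]].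

Definition avoids (n : nat) (w : 'S_n) (ps : seq (seq nat)) : bool :=
  all (fun p => ~~ contains w p) ps.

Definition freely_braided (n : nat) (w : 'S_n) : bool :=
  avoids w [:: [:: 4; 2; 3; 1]; [:: 3; 4; 2; 1];
               [:: 4; 3; 1; 2]; [:: 4; 3; 2; 1]]%N.

Definition maximally_clustered (n : nat) (w : 'S_n) : bool :=
  avoids w [:: [:: 3; 4; 2; 1]; [:: 4; 3; 1; 2]; [:: 4; 3; 2; 1]]%N.

Definition hexagon_avoiding (n : nat) (w : 'S_n) : bool :=
  avoids w [:: [:: 4; 6; 7; 1; 8; 2; 3; 5]; [:: 4; 6; 7; 8; 1; 2; 3; 5];
               [:: 5; 6; 7; 1; 8; 2; 3; 4]; [:: 5; 6; 7; 8; 1; 2; 3; 4]]%N.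

Record fps (R : Type) := Fps { fps_coef :> nat -> R }.

HB.instance Definition _ (R : Type) := gen_eqMixin (fps R).
HB.instance Definition _ (R : Type) := gen_choiceMixin (fps R).

Lemma fpsP (R : Type) (f g : fps R) : (forall n, f n = g n) -> f = g.
Proof. by case: f g => [f] [g] /= fg; congr Fps; apply/funext. Qed.

Section FpsZmodule.
Variable R : zmodType.
Implicit Types f g h : fps R.

Definition fps_zero : fps R := Fps (fun _ => 0).
Definition fps_opp f : fps R := Fps (fun n => - f n).
Definition fps_add f g : fps R := Fps (fun n => f n + g n).

Fact fps_addA : associative fps_add.
Proof. by move=> f g h; apply: fpsP => n; rewrite /= addrA. Qed.
Fact fps_addC : commutative fps_add.
Proof. by move=> f g; apply: fpsP => n; rewrite /= addrC. Qed.
Fact fps_add0 : left_id fps_zero fps_add.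
Proof. by move=> f; apply: fpsP => n; rewrite /= add0r. Qed.
Fact fps_addN : left_inverse fps_zero fps_opp fps_add.
Proof. by move=> f; apply: fpsP => n; rewrite /= addNr. Qed.

HB.instance Definition _ :=
  GRing.isZmodule.Build (fps R) fps_addA fps_addC fps_add0 fps_addN.

Lemma coef_fps0 n : (0 : fps R) n = 0. Proof. by []. Qed.
Lemma coef_fpsD f g n : (f + g) n = f n + g n. Proof. by []. Qed.
Lemma coef_fpsN f n : (- f) n = - f n. Proof. by []. Qed.
Lemma coef_fpsB f g n : (f - g) n = f n - g n. Proof. by []. Qed.

End FpsZmodule.

Section FpsRing.
Variable R : comNzRingType.
Implicit Types f g h : fps R.

Definition fps_one : fps R := Fps (fun n => (n == 0%N)%:R).
Definition fps_mul f g : fps R :=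
  Fps (fun n => \sum_(i < n.+1) f i * g (n - i)%N).

Definition fps_trunc (n : nat) f : {poly R} := \poly_(i < n) f i.

Lemma coef_fps_trunc n f i : (fps_trunc n f)`_i = if (i < n)%N then f i else 0.
Proof. by rewrite coef_poly. Qed.

Lemma fps_mul_poly (p q : {poly R}) f g n :
    (forall i, (i <= n)%N -> p`_i = f i) ->
    (forall i, (i <= n)%N -> q`_i = g i) ->
  forall i, (i <= n)%N -> (p * q)`_i = fps_mul f g i.
Proof.
move=> pf qg i le_in; rewrite coefM; apply: eq_bigr => j _.
rewrite pf ?qg //; first by rewrite (leq_trans (leq_subr _ _)).
by rewrite (leq_trans _ le_in) // -ltnS.
Qed.

Let truncE n f i : (i <= n)%N -> (fps_trunc n.+1 f)`_i = f i.
Proof. by move=> le_in; rewrite coef_fps_trunc ltnS le_in. Qed.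

Fact fps_mulA : associative fps_mul.
Proof.
move=> f g h; apply: fpsP => n.
rewrite -(@fps_mul_poly (fps_trunc n.+1 f)
            (fps_trunc n.+1 g * fps_trunc n.+1 h) _ _ n) //; first last.
- by apply: fps_mul_poly => i; apply: truncE.
- exact: truncE.
rewrite mulrA.
apply: (@fps_mul_poly _ _ _ _ n) => //; last exact: truncE.
by apply: fps_mul_poly => i; apply: truncE.
Qed.

Fact fps_mulC : commutative fps_mul.
Proof.
move=> f g; apply: fpsP => n.
rewrite -(@fps_mul_poly (fps_trunc n.+1 f) (fps_trunc n.+1 g) _ _ n) //;
  [|exact: truncE..].
by rewrite mulrC; apply: (@fps_mul_poly _ _ _ _ n) => //; apply: truncE.
Qed.

Fact fps_mul1 : left_id fps_one fps_mul.
Proof.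
move=> f; apply: fpsP => n /=.
rewrite big_ord_recl /= mul1r subn0 big1 ?addr0 // => i _.
by rewrite /bump /= mul0r.
Qed.

Fact fps_mulDl : left_distributive fps_mul +%R.
Proof.
move=> f g h; apply: fpsP => n /=; rewrite -big_split /=.
by apply: eq_bigr => i _; rewrite mulrDl.
Qed.

Fact fps_oner_neq0 : fps_one != 0.
Proof.
apply/eqP => /(congr1 (fun f : fps R => f 0%N)) /= /eqP.
by rewrite oner_eq0.
Qed.

HB.instance Definition _ := GRing.Zmodule_isComNzRing.Build (fps R)
  fps_mulA fps_mulC fps_mul1 fps_mulDl fps_oner_neq0.

Lemma coef_fps1 n : (1 : fps R) n = (n == 0%N)%:R. Proof. by []. Qed.
Lemma coef_fpsM f g n : (f * g) n = \sum_(i < n.+1) f i * g (n - i)%N.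
Proof. by []. Qed.
Lemma coef0_fpsM f g : (f * g) 0%N = f 0%N * g 0%N.
Proof. by rewrite coef_fpsM big_ord1. Qed.

Definition fpsX : fps R := Fps (fun n => (n == 1%N)%:R).

Lemma coef_fpsX n : fpsX n = (n == 1%N)%:R. Proof. by []. Qed.

(* Course-of-values recursion: if F n u depends only on the u i with i < n,
   then fps_rec F is the sequence u such that u n = F n u for all n. *)
Fixpoint fps_rec_seq (F : nat -> (nat -> R) -> R) (n : nat) : seq R :=
  if n is m.+1 then rcons (fps_rec_seq F m) (F m (nth 0 (fps_rec_seq F m)))
  else [::].

Definition fps_rec (F : nat -> (nat -> R) -> R) : fps R :=
  Fps (fun n => nth 0 (fps_rec_seq F n.+1) n).

Lemma fps_recE (F : nat -> (nat -> R) -> R) :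
    (forall n (u v : nat -> R),
       (forall i, (i < n)%N -> u i = v i) -> F n u = F n v) ->
  forall n, fps_rec F n = F n (fps_rec F).
Proof.
move=> Fext n.
have sz m : size (fps_rec_seq F m) = m.
  by elim: m => //= m IHm; rewrite size_rcons IHm.
have nthE m i : (i < m)%N -> nth 0 (fps_rec_seq F m) i = fps_rec F i.
  elim: m => // m IHm; rewrite ltnS leq_eqVlt => /orP[/eqP -> //|lt_im].
  by rewrite /= nth_rcons sz lt_im IHm.
rewrite {1}/fps_rec /= nth_rcons sz ltnn eqxx; apply: Fext => i.
exact: nthE.
Qed.

End FpsRing.

Arguments fpsX {R}.

Section FpsUnitRing.
Variable R : comUnitRingType.
Implicit Types f g h : fps R.

Definition fps_unit : {pred fps R} := fun f => f 0%N \is a GRing.unit.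

Definition fps_inv_rec f (n : nat) (u : nat -> R) : R :=
  (f 0%N)^-1 * ((n == 0%N)%:R - \sum_(i < n) u i * f (n - i)%N).

Definition fps_inv f : fps R :=
  if f \in fps_unit then fps_rec (fps_inv_rec f) else f.

Fact fps_mulVf : {in fps_unit, left_inverse 1 fps_inv *%R}.
Proof.
move=> f uf; rewrite /fps_inv uf.
have gE : forall n, fps_rec (fps_inv_rec f) n
    = fps_inv_rec f n (fps_rec (fps_inv_rec f)).
  apply: fps_recE => m u v uv; congr (_ * (_ - _)).
  by apply: eq_bigr => i _; rewrite uv.
move: (fps_rec _) gE => g gE; apply: fpsP => n.
rewrite coef_fpsM big_ord_recr /= subnn gE /fps_inv_rec [_^-1 * _]mulrC.
by rewrite mulrVK // addrC subrK.
Qed.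

Fact fps_unitPl f g : g * f = 1 -> fps_unit f.
Proof.
move=> /(congr1 (fun h : fps R => h 0%N)); rewrite coef0_fpsM mulrC => fg1.
by apply/unitrP; exists (g 0%N); split; rewrite // mulrC.
Qed.

Fact fps_inv_out : {in [predC fps_unit], fps_inv =1 id}.
Proof. by move=> f; rewrite inE /= /fps_inv => /negbTE ->. Qed.

HB.instance Definition _ := GRing.ComNzRing_hasMulInverse.Build (fps R)
  fps_mulVf fps_unitPl fps_inv_out.

Lemma fps_unitE f : (f \is a GRing.unit) = (f 0%N \is a GRing.unit).
Proof. by []. Qed.

End FpsUnitRing.

Section FpsIdomain.
Variable R : idomainType.

Fact fps_integral : GRing.integral_domain_axiom (fps R).
Proof.
move=> f g fg0; apply: contrapT => /negP; rewrite negb_or => /andP[f0 g0].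
have nz (h : fps R) : h != 0 ->
    exists2 m, h m != 0 & forall i, (i < m)%N -> h i = 0.
  move=> h0; have ex_h : exists m, h m != 0.
    apply: contrapT => /forallNP hN; move/eqP: h0; apply; apply: fpsP => m.
    by apply/eqP; have /negP := hN m; rewrite negbK.
  case: (ex_minnP ex_h) => m hm min_m; exists m => // i lt_im.
  apply/eqP; apply: contraLR lt_im => hi; rewrite -leqNgt; exact: min_m.
have [a fa fa0] := nz _ f0; have [b gb gb0] := nz _ g0.
have := congr1 (fun h : fps R => h (a + b)%N) fg0.
rewrite coef_fpsM coef_fps0 (bigD1 (inord a)) //= big1 ?addr0; last first.
  move=> i; rewrite -val_eqE /= inordK ?ltnS ?leq_addr // neq_ltn.
  case/orP => [lt_ia|lt_ai]; first by rewrite fa0 ?mul0r.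
  rewrite gb0 ?mulr0 // ltn_subLR ?ltn_add2r // -ltnS //.
rewrite inordK ?ltnS ?leq_addr // addKn => /eqP.
by rewrite mulf_eq0 (negbTE fa) (negbTE gb).
Qed.

HB.instance Definition _ :=
  GRing.ComUnitRing_isIntegral.Build (fps R) fps_integral.

End FpsIdomain.

(* For a field F, the field F((x)) of formal Laurent series is the fraction
   field of F[[x]]: by laurentP, its elements are the f / x^n. *)
Notation laurent F := {fraction (fps F)}.

Notation "f %:L" := (@FracField.tofrac (fps _) f)
  (at level 1, left associativity, format "f %:L") : ring_scope.

Section Laurent.
Variable F : fieldType.
Implicit Types f g : fps F.

Lemma coef_fpsXnM n f i :
  (fpsX ^+ n * f) i = if (i < n)%N then 0 else f (i - n)%N.
Proof.
elim: n i => [|n IHn] i; first by rewrite expr0 mul1r ltn0 subn0.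
rewrite exprS -mulrA coef_fpsM; case: i => [|i].
  by rewrite big_ord1 coef_fpsX mul0r.
rewrite !big_ord_recl big1 => [|j _]; last by rewrite coef_fpsX mul0r.
have -> : (i.+1 - lift ord0 (@ord0 i))%N = i by rewrite /= subn1.
by rewrite IHn !coef_fpsX mul0r mul1r add0r addr0.
Qed.

Lemma fpsX_neq0 : fpsX != 0 :> fps F.
Proof.
apply/eqP => /(congr1 (fun f : fps F => f 1%N)) /eqP.
by rewrite coef_fpsX coef_fps0 oner_eq0.
Qed.

Lemma fps_factor g :
  g != 0 -> exists n u, u \is a GRing.unit /\ g = fpsX ^+ n * u.
Proof.
move=> g0; have ex_g : exists n, g n != 0.
  apply: contrapT => /forallNP gN; move/eqP: g0; apply; apply: fpsP => n.
  by apply/eqP; have /negP := gN n; rewrite negbK.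
case: (ex_minnP ex_g) => n gn min_n.
exists n, (Fps (fun i => g (n + i)%N)).
split; first by rewrite fps_unitE unitfE /= addn0.
apply: fpsP => i; rewrite coef_fpsXnM; case: ltnP => [lt_in|le_ni].
  by apply/eqP; apply: contraLR lt_in => gi; rewrite -leqNgt; exact: min_n.
by rewrite /= subnKC.
Qed.

Lemma laurentP (a : laurent F) :
  exists f n, a = f%:L / (fpsX : fps F)%:L ^+ n.
Proof.
have [f [g g0 ->]] : exists f, exists2 g, g != 0 & a = f%:L / g%:L.
  elim/quotW: a => r; exists r.1, r.2; first exact: denom_ratioP.
  have dr0 : (r.2)%:L != 0 :> laurent F by rewrite tofrac_eq0 denom_ratioP.
  apply: (mulIf dr0); rewrite divfK //.
  unlock FracField.tofrac; rewrite -[LHS]FracField.pi_mul.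
  apply/eqmodP; rewrite /= FracField.equivfE /FracField.mulf.
  by rewrite !numden_Ratio ?mulf_neq0 ?denom_ratioP ?oner_neq0 // !mulr1 mulrC.
have [n [u [uu gE]]] := fps_factor g0.
have u0 : u%:L != 0 :> laurent F.
  by rewrite tofrac_eq0; apply: contraTneq uu => ->; rewrite unitr0.
have x0 : (fpsX : fps F)%:L ^+ n != 0.
  by rewrite expf_neq0 // tofrac_eq0 fpsX_neq0.
exists (f * u^-1), n; apply: (mulIf x0); rewrite divfK //.
have -> : f%:L = (f * u^-1)%:L * u%:L by rewrite -tofracM mulrVK.
set b := (f * _)%:L; rewrite gE tofracM tofracXn -!mulrA -[RHS]mulr1.
congr (_ * _).
by rewrite mulrCA mulrC [u%:L * _]mulrC mulfV // mulf_neq0.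
Qed.

End Laurent.

(* The square root of g with constant term 1, and 0 if there is none;
   existence and uniqueness are fps_sqrtP and fps_sqrt_unique. *)
Definition fps_sqrt (F : numFieldType) (g : fps F) : fps F :=
  xget 0 [set s : fps F | s 0%N = 1 /\ s ^+ 2 = g].

Section FpsSqrt.
Variable F : numFieldType.
Implicit Types g s t : fps F.

Lemma fps_sqrt_exists g :
  g 0%N = 1 -> exists s : fps F, s 0%N = 1 /\ s ^+ 2 = g.
Proof.
move=> g0.
pose G n (u : nat -> F) : F := if n is m.+1 then
  (g m.+1 - \sum_(i < m) u i.+1 * u (m - i)%N) / 2 else 1.
have sE : forall n, fps_rec G n = G n (fps_rec G).
  apply: fps_recE => -[|m] u v uv //=; congr ((_ - _) / _).
  apply: eq_bigr => i _; rewrite !uv // ?ltnS //.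
  by rewrite leq_subr.
move: (fps_rec G) sE => s sE; exists s; split; first by rewrite sE.
apply: fpsP => -[|m]; first by rewrite expr2 coef0_fpsM !sE /= mulr1 g0.
rewrite expr2 coef_fpsM big_ord_recl big_ord_recr /= subnn subn0.
rewrite (sE 0%N) (sE m.+1) mul1r mulr1 /=.
set S := \sum_(i < m) _; rewrite -/S.
by rewrite addrCA -splitr addrC subrK.
Qed.

Lemma fps_sqrtP g :
  g 0%N = 1 -> fps_sqrt g 0%N = 1 /\ fps_sqrt g ^+ 2 = g.
Proof.
move=> /fps_sqrt_exists sP.
exact: (@xgetPex _ 0 [set s : fps F | s 0%N = 1 /\ s ^+ 2 = g] sP).
Qed.

Lemma fps_sqrt_unique g s : s 0%N = 1 -> s ^+ 2 = g -> s = fps_sqrt g.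
Proof.
move=> s0 sg; have g0 : g 0%N = 1 by rewrite -sg expr2 coef0_fpsM s0 mulr1.
have [t0 tg] := fps_sqrtP g0.
have /eqP : s ^+ 2 = fps_sqrt g ^+ 2 by rewrite sg tg.
rewrite eqf_sqr => /orP[/eqP //|/eqP sN].
have /eqP := congr1 (fun h : fps F => h 0%N) sN.
by rewrite coef_fpsN s0 t0 -addr_eq0 -mulr2n pnatr_eq0.
Qed.

End FpsSqrt.

(* Main.v *)
Require Import Defs.
From mathcomp Require Import all_boot all_order all_fingroup all_algebra.
From mathcomp Require Import boolp zify ssrZ ring.

(** (1) Insert the maxima one at a time. A maximally clustered permutation has a
    label (m, q): a new maximum may be inserted at the m + 1 rightmost sites, and
    q is the length of the longest increasing suffix. Inserting with j letters on
    the right leads to (m + 1, q + 1) for j = 0, to (m + 1, 1) for j = 1, and to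
    (t, t) with t = min(j, q) otherwise. With C = 1 + x C^2 and
    G = 1 / (2 - x - C), the series counting the descendants of (m, q) is
    G (1 - C + C^q + (m - q) (C^q - C^(q - 1))), and the tree starts at (1, 1).

    (2) and (3) Remove the maxima one at a time (the insertion encoding read
    backwards). Each maximal block of remaining letters forms one of s nonempty
    slots, and the avoidance condition becomes a set of slotted patterns to be
    avoided. Up to equivalence only finitely many such states can be completed to
    a permutation, so a finite automaton counts the permutations. The equivalences
    are proved by resolution: a pattern P may be added as soon as each way of
    adding to P a letter in a slot unused by P contains a forbidden pattern.
    The defect of the expected recurrence satisfies another linear recurrence, read
    off the transition matrix, and its initial values vanish. *)

Set Implicit Arguments.
Unset Strict Implicit.
Unset Printing Implicit Defensive.

Import GRing.Theory.

Local Open Scope nat_scope.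

(** * Occurrences of patterns in labelled words *)

(** The series in (1) is not rational, so no finite automaton can produce it, and a tree with two
    unbounded labels takes its place. Forbidding the hexagons as well makes finitely many states
    suffice. The automaton is data and not a construction. A certificate lists states and
    transitions, and evaluation confirms that each move leads to a dead end or to a state equivalent
    to the listed one. Hence only the soundness of the tests is proved: a test that fails too often
    could reject a certificate, but never validate a wrong one. A recurrence for the start state
    cannot be verified on all states at once. In both automata the state 2 never returns to the
    start; its counts are powers of 2 for (3) and Fibonacci numbers for (2), which violate the
    expected recurrence. So the vector of defects is not zero, and only its coordinate 0 vanishes at
    all lengths; this is why the defect needs a second recurrence of its own. *)

Definition word := seq (nat * nat).

Definition matching (z : seq ((nat * nat) * (nat * nat))) : Prop :=
  {in z, forall e, e.1.1 = e.2.1} /\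
  {in z &, forall e f, (e.1.2 < f.1.2) = (e.2.2 < f.2.2)}.

Definition occurs (p u : word) : Prop :=
  exists z, [/\ matching z, unzip1 z = p & subseq (unzip2 z) u].

Lemma mem_zip_unzip (T U V : eqType) (y : seq (T * U)) (z : seq (U * V)) e :
  unzip2 y = unzip1 z -> e \in zip (unzip1 y) (unzip2 z) ->
  exists2 b, (e.1, b) \in y & (b, e.2) \in z.
Proof.
elim: y z => [|[a b] y IHy] [|[b' c] z] //= [<- yz]; rewrite inE.
case/predU1P => [->|/(IHy _ yz)[d yd zd]]; first by exists b; rewrite inE eqxx.
by exists d; rewrite inE ?yd ?zd orbT.
Qed.

Lemma occurs_trans q p u : occurs q p -> occurs p u -> occurs q u.
Proof.
move=> [y [[y1 y2] <- yp]] [z [[z1 z2] zp zu]].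
have /subseqP[m sm ym] := yp; rewrite -zp /unzip1 -map_mask in ym.
set z' := mask m z in ym; have zz' : {subset z' <= z} by move=> e /mem_mask.
have eqsz : size (unzip1 y) = size (unzip2 z').
  by have := congr1 size ym; rewrite !size_map.
exists (zip (unzip1 y) (unzip2 z')); split; last 2 first.
- by rewrite unzip1_zip // eqsz.
- rewrite unzip2_zip ?eqsz //; apply: subseq_trans zu.
  by rewrite /unzip2 map_mask mask_subseq.
split=> [e|e f] /(mem_zip_unzip ym)[b yb zb].
  by rewrite (y1 _ yb) -(z1 _ (zz' _ zb)).
move=> /(mem_zip_unzip ym)[c yc zc].
by rewrite (y2 _ _ yb yc) -(z2 _ _ (zz' _ zb) (zz' _ zc)).
Qed.

Lemma subseq_catP (T : eqType) (s s1 s2 : seq T) : subseq s (s1 ++ s2) ->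
  exists t1 t2, [/\ s = t1 ++ t2, subseq t1 s1 & subseq t2 s2].
Proof.
move=> /subseqP[m]; rewrite size_cat => sm ->.
exists (mask (take (size s1) m) s1), (mask (drop (size s1) m) s2).
split; rewrite ?mask_subseq // -[in LHS](cat_take_drop (size s1) m) mask_cat //.
by rewrite size_takel // sm leq_addr.
Qed.

Lemma unzip2_catP (T U : eqType) (z : seq (T * U)) t1 t2 :
  unzip2 z = t1 ++ t2 ->
  exists z1 z2, [/\ z = z1 ++ z2, unzip2 z1 = t1 & unzip2 z2 = t2].
Proof.
move=> zt; exists (take (size t1) z), (drop (size t1) z).
by rewrite cat_take_drop /unzip2 map_take map_drop [map _ z]zt take_size_cat ?drop_size_cat.
Qed.

Lemma unzip1_catP (T U : eqType) (z : seq (T * U)) t1 t2 :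
  unzip1 z = t1 ++ t2 ->
  exists z1 z2, [/\ z = z1 ++ z2, unzip1 z1 = t1 & unzip1 z2 = t2].
Proof.
move=> zt; exists (take (size t1) z), (drop (size t1) z).
by rewrite cat_take_drop /unzip1 map_take map_drop [map _ z]zt take_size_cat ?drop_size_cat.
Qed.

Lemma filter_none T (a : pred T) s : all (predC a) s -> [seq x <- s | a x] = [::].
Proof. by elim: s => //= x s IHs /andP[/negPf -> /IHs]. Qed.

Lemma sorted_split (T : eqType) (f : T -> nat) (s : seq T) c :
  sorted leq (map f s) ->
  s = [seq x <- s | f x < c] ++ [seq x <- s | c <= f x].
Proof.
elim: s => //= x s IHs xs.
have ss := path_sorted xs.
case: ltnP => [lt_xc|le_cx] /=; first by rewrite -IHs.
have H : all (fun y => c <= f y) s.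
  apply/allP => y ys; apply: leq_trans le_cx _.
  have := order_path_min leq_trans xs.
  by move=> /allP; apply; apply: map_f.
have -> : [seq x0 <- s | f x0 < c] = [::].
  by apply: filter_none; apply: sub_all H => y /=; rewrite -leqNgt.
by rewrite /=; congr cons; apply/esym/all_filterP.
Qed.

(** * Pattern occurrences under the insertion of a new maximum *)

Section Insertion.
Variables (i : nat) (l r : bool).

(** The labels that a letter before, resp. after, the new maximum can carry in the word containing
    it: the label [i] itself occurs only on a side whose flag is set. *)
Definition okl (b : nat) : bool := if b < i then true else if l then b == i else false.
Definition okr (b : nat) : bool := if i < b then true else if r then b == i else false.

(* When the slot i is replaced with its nonempty parts on the left and on the right
   of the new letter, shift relabels the letters on the right of the cut. *)
Definition shift (x : nat * nat) : nat * nat :=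
  (if x.1 == i then i + l else x.1.-1 + l + r, x.2).
Definition unshift (x : nat * nat) : nat * nat :=
  (if r && (x.1 == i + l) then i else x.1.+1 - (l + r), x.2).

Definition build (n : nat) (u : word) : word :=
  [seq x <- u | x.1 < i + l] ++ (i, n) :: map unshift [seq x <- u | i + l <= x.1].

Lemma oklE b : okl b = (b < i + l).
Proof. by rewrite /okl; case: l => /=; case: ifP => h; lia. Qed.

Lemma okrE b : okr b = (i < b) || (r && (b == i)).
Proof. by rewrite /okr; case: r; case: ifP. Qed.

Lemma okr_shift x : okr x.1 -> i + l <= (shift x).1.
Proof. by rewrite okrE /shift /=; case: ifP => h1 h2; lia. Qed.

Lemma shiftK x : okr x.1 -> unshift (shift x) = x.
Proof.
case: x => b v; rewrite okrE /shift /unshift /= => h; congr pair.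
by case: (b =P i) h => [->|ne] h; case: ifP; lia.
Qed.

Lemma unshift_okr x : i + l <= x.1 -> okr (unshift x).1.
Proof. by rewrite okrE /unshift /=; case: ifP => h; lia. Qed.

Lemma unshift_ge x : i + l <= x.1 -> i <= (unshift x).1.
Proof. by move/unshift_okr; rewrite okrE; lia. Qed.

Lemma unshiftK x : i + l <= x.1 -> shift (unshift x) = x.
Proof.
case: x => b v; rewrite /shift /unshift /= => h; congr pair.
by case: (boolP (r && (b == i + l))) => h1; case: ifP; lia.
Qed.

Lemma shift_mono x y : okr x.1 -> okr y.1 -> x.1 <= y.1 -> (shift x).1 <= (shift y).1.
Proof.
rewrite !okrE /shift /=; move: x.1 y.1 => a b.
by case: (a =P i) => h; case: (b =P i) => h'; lia.
Qed.

Lemma shift_lt s x : okr x.1 -> x.1 < s -> (shift x).1 < s.-1 + l + r.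
Proof.
have := leq_b1 r; rewrite okrE /shift /=; move: x.1 => a.
by case: (a =P i) => h; case: r; lia.
Qed.

(* The patterns which must occur in u for p to occur in build n u: raws when n is
   not used, rawu when n plays the part of the maximum m of p. *)
Fixpoint raws (p : word) : seq word :=
  match p with
  | [::] => [:: [::]]
  | x :: p' =>
    (if all (fun y => okr y.1) p then cons (map shift p) else id)
    (if okl x.1 then map (cons x) (raws p') else [::])
  end.

Fixpoint rawu (m : nat) (p : word) : seq word :=
  match p with
  | [::] => [::]
  | x :: p' =>
    (if (x == (i, m)) && all (fun y => okr y.1 && (y.2 < m)) p'
     then cons (map shift p') else id)
    (if okl x.1 && (x.2 < m) then map (cons x) (rawu m p') else [::])
  end.

Definition raw (p : word) := rawu (foldr (fun x => maxn x.2) 0 p) p ++ raws p.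

Lemma rawsP p p' : reflect
  (exists p1 p2, [/\ p = p1 ++ p2, all (fun x => okl x.1) p1,
      all (fun x => okr x.1) p2 & p' = p1 ++ map shift p2])
  (p' \in raws p).
Proof.
elim: p p' => [|x p IHp] p' /=.
  rewrite inE; apply: (iffP eqP) => [->|[[|? ?] [[|? ?] []]] //].
  by exists [::], [::].
apply: (iffP idP) => [|[p1 [p2 [ep ok1 ok2 ->]]]].
- have tailP : p' \in (if okl x.1 then map (cons x) (raws p) else [::]) ->
    exists p1 p2, [/\ x :: p = p1 ++ p2, all (fun x => okl x.1) p1,
      all (fun x => okr x.1) p2 & p' = p1 ++ map shift p2].
    case: ifP => // okx /mapP[q /IHp[p1 [p2 [-> ok1 ok2 ->]]] ->].
    by exists (x :: p1), p2; rewrite /= okx.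
  case: ifP => //= ok; rewrite inE => /predU1P[->|//].
  by exists [::], (x :: p); rewrite /= ok.
- case: p1 ep ok1 => [/= ep _|y p1 [<- ep] /= /andP[okx ok1]].
    by move: ok2; rewrite -ep /= => ->; rewrite inE eqxx.
  rewrite okx; set s := map (cons x) (raws p).
  have sP : x :: p1 ++ map shift p2 \in s.
    by apply: map_f; apply/IHp; exists p1, p2.
  by case: ifP => // _; rewrite inE sP orbT.
Qed.

Lemma rawuP m p p' : reflect
  (exists p1 p2, [/\ p = p1 ++ (i, m) :: p2,
      all (fun x => okl x.1 && (x.2 < m)) p1,
      all (fun x => okr x.1 && (x.2 < m)) p2 & p' = p1 ++ map shift p2])
  (p' \in rawu m p).
Proof.
elim: p p' => [|x p IHp] p' /=.
  by constructor; case=> [[|? ?] [? []]].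
apply: (iffP idP) => [|[p1 [p2 [ep ok1 ok2 ->]]]].
- have tailP : p' \in (if okl x.1 && (x.2 < m) then map (cons x) (rawu m p) else [::]) ->
    exists p1 p2, [/\ x :: p = p1 ++ (i, m) :: p2,
      all (fun x => okl x.1 && (x.2 < m)) p1,
      all (fun x => okr x.1 && (x.2 < m)) p2 & p' = p1 ++ map shift p2].
    case: ifP => // okx /mapP[q /IHp[p1 [p2 [-> ok1 ok2 ->]]] ->].
    by exists (x :: p1), p2; rewrite /= okx.
  case: ifP => //= /andP[/eqP ex ok]; rewrite inE => /predU1P[->|//].
  by exists [::], p; rewrite /= ok ex.
- case: p1 ep ok1 => [/= [-> ->] _|y p1 [<- ep] /= /andP[okx ok1]].
    by rewrite eqxx ok2 inE eqxx.
  rewrite okx; set s := map (cons x) (rawu m p).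
  have sP : x :: p1 ++ map shift p2 \in s.
    by apply: map_f; apply/IHp; exists p1, p2.
  by case: ifP => // _; rewrite inE sP orbT.
Qed.

Lemma foldr_maxn m (p1 p2 : word) :
  all (fun x => x.2 < m) p1 -> all (fun x => x.2 < m) p2 ->
  foldr (fun x => maxn x.2) 0 (p1 ++ (i, m) :: p2) = m.
Proof.
elim: p1 => [_|x p1 IHp /= /andP[xm /IHp H] /H ->]; last by apply/maxn_idPr/ltnW.
move=> /= p2m; apply/maxn_idPl; elim: p2 p2m => //= x p2 IHp /andP[xm /IHp].
by rewrite geq_max (ltnW xm).
Qed.

Lemma sub_matching z z' : matching z -> {subset z' <= z} -> matching z'.
Proof. by case=> m1 m2 sz; split=> [e /sz/m1|e f /sz ez /sz]; last exact: m2. Qed.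

Lemma matching_relabel (g : nat * nat -> nat * nat) z z' :
  (forall x, (g x).2 = x.2) -> (forall x y, x.1 = y.1 -> (g x).1 = (g y).1) ->
  matching (z ++ z') -> matching (z ++ map (fun e => (g e.1, g e.2)) z').
Proof.
move=> g2 g1 [m1 m2].
have emb e : e \in z ++ map (fun e => (g e.1, g e.2)) z' ->
    exists2 f, f \in z ++ z' & [/\ e.1.2 = f.1.2, e.2.2 = f.2.2 &
                                e = f \/ e = (g f.1, g f.2)].
  rewrite mem_cat => /orP[ez|/mapP[f fz ->]].
    by exists e; [rewrite mem_cat ez | split=> //; left].
  by exists f; [rewrite mem_cat fz orbT | split=> //=; right].
split=> [e|e f] /emb[f' fz [e1 e2]].
  by case=> -> //=; [exact: m1|apply/g1/m1].
by move=> _ /emb[g' gz [-> -> _]]; rewrite e1 e2 m2.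
Qed.

Lemma unzip1_relabel (g : nat * nat -> nat * nat) z :
  unzip1 (map (fun e => (g e.1, g e.2)) z) = map g (unzip1 z).
Proof. by rewrite /unzip1 -!map_comp. Qed.

Lemma unzip2_relabel (g : nat * nat -> nat * nat) z :
  unzip2 (map (fun e => (g e.1, g e.2)) z) = map g (unzip2 z).
Proof. by rewrite /unzip2 -!map_comp. Qed.

Lemma matching_max z1 z2 e : matching (z1 ++ z2) -> e.1.1 = e.2.1 ->
  {in z1 ++ z2, forall f, f.1.2 < e.1.2 /\ f.2.2 < e.2.2} ->
  matching (z1 ++ e :: z2).
Proof.
move=> [m1 m2] e1 emax; split=> [f|f f'];
  rewrite !mem_cat !inE orbCA -mem_cat; first by case/predU1P => [->//|/m1].
rewrite orbCA -mem_cat.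
case/predU1P => [->|fz]; case/predU1P => [->|fz'].
- by rewrite !ltnn.
- by have [h1 h2] := emax _ fz'; rewrite (leq_gtF (ltnW h1)) (leq_gtF (ltnW h2)).
- by have [-> ->] := emax _ fz.
- exact: m2.
Qed.

(** An occurrence in [build n u] splits at the new letter. Relabelling pattern and word together on
    the right of the cut keeps it a matching and makes it an occurrence in [u]. If [n] is used, it
    is matched with the greatest letter of [p], which has label [i] and is dropped. *)
Lemma rawP n p u : sorted leq (unzip1 u) -> all (fun x => x.2 < n) u ->
  occurs p (build n u) <-> exists2 p', p' \in raw p & occurs p' u.
Proof.
move=> us un; set A := [seq x <- u | x.1 < i + l]; set B := [seq x <- u | i + l <= x.1].
have uE : u = A ++ B by apply: sorted_split.
have AP x : x \in A -> x.1 < i + l by rewrite mem_filter => /andP[].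
have BP x : x \in B -> i + l <= x.1 by rewrite mem_filter => /andP[].
have uS x : x \in map unshift B -> okr x.1 /\ x.2 < n.
  move=> /mapP[y yB ->]; split; first exact/unshift_okr/BP.
  by have /allP/(_ y) := un; rewrite uE mem_cat yB orbT => ->.
have SB : map shift (map unshift B) = B.
  by rewrite -map_comp map_id_in // => x /BP/unshiftK.
have occS z1 z2 : matching (z1 ++ z2) -> subseq (unzip2 z1) A ->
    subseq (unzip2 z2) (map unshift B) ->
    occurs (unzip1 z1 ++ map shift (unzip1 z2)) u.
  move=> mz s1 s2; exists (z1 ++ map (fun e => (shift e.1, shift e.2)) z2); split.
    by apply: matching_relabel => // x y; rewrite /shift => ->.
    by rewrite /unzip1 map_cat [X in _ ++ X]unzip1_relabel.
  rewrite /unzip2 map_cat [X in _ ++ X]unzip2_relabel uE; apply: cat_subseq => //.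
  by rewrite -SB; apply: map_subseq.
have labz (z : seq ((nat * nat) * (nat * nat))) (t : word) :
    matching z -> {subset unzip2 z <= t} ->
    forall x, x \in unzip1 z -> exists2 y, y \in t & x.1 = y.1.
  by case=> m1 _ zt x /mapP[e ez ->]; exists e.2; [apply/zt/map_f | rewrite m1].
split.
- move=> [z [mz zp /subseq_catP[t1 [t2 [/unzip2_catP[z1 [z2 [zE <- <-]]] s1 s2]]]]].
  have okz1 : all (fun x => okl x.1) (unzip1 z1).
    have mz1 : matching z1 by apply: sub_matching mz _ => e; rewrite zE mem_cat => ->.
    apply/allP => x /(labz _ _ mz1 (mem_subseq s1))[y /AP yA ->].
    by rewrite oklE.
  have okB z' : {subset z' <= z} -> subseq (unzip2 z') (map unshift B) ->
      all (fun x => okr x.1) (unzip1 z').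
    move=> /(sub_matching mz) mz' s'.
    apply/allP => x /(labz _ _ mz' (mem_subseq s'))[y yB ->].
    by case: (uS _ yB).
  case: z2 zE s2 => [|e z2] zE s2.
    exists (unzip1 z1).
      rewrite mem_cat; apply/orP; right; apply/rawsP.
      by exists (unzip1 z1), [::]; rewrite -zp zE /unzip1 map_cat /= !cats0.
    by rewrite -[unzip1 z1]cats0; apply: (occS z1 [::]); rewrite -?zE ?sub0seq.
  (* The letters matched from the cut on form a subword of [(i, n) :: map unshift B], so only the
     first of them can be [n]. *)
  case: (e.2 =P (i, n)) => [en|/eqP/negPf en].
    have {}s2 : subseq (unzip2 z2) (map unshift B) by move: s2; rewrite /= en eqxx.
    have sz : {subset z1 ++ z2 <= z}.
      by move=> f; rewrite zE !mem_cat inE => /orP[] -> //; rewrite !orbT.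
    have ez : e \in z by rewrite zE mem_cat inE eqxx orbT.
    have lt2 f : f \in z1 ++ z2 -> f.1.2 < e.1.2.
      case: mz => _ m2 fz; rewrite m2 // ?sz // en /=.
      move: fz; rewrite mem_cat => /orP[fz|fz].
        have /(mem_subseq s1) : f.2 \in unzip2 z1 by apply: map_f.
        by rewrite mem_filter => /andP[_ fu]; have /allP/(_ _ fu) := un.
      have /(mem_subseq s2) : f.2 \in unzip2 z2 by apply: map_f.
      by case/uS.
    have le1 : all (fun x => x.2 < e.1.2) (unzip1 z1).
      by apply/allP => x /mapP[f fz ->]; apply: lt2; rewrite mem_cat fz.
    have le2 : all (fun x => x.2 < e.1.2) (unzip1 z2).
      by apply/allP => x /mapP[f fz ->]; apply: lt2; rewrite mem_cat fz orbT.
    have pE : p = unzip1 z1 ++ (i, e.1.2) :: unzip1 z2.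
      rewrite -zp zE /unzip1 map_cat /=; congr (_ ++ _ :: _).
      by case: mz => /(_ _ ez) + _; rewrite en; case: (e.1) => ? ? /= ->.
    exists (unzip1 z1 ++ map shift (unzip1 z2)); last first.
      by apply: occS => //; apply: sub_matching mz sz.
    rewrite mem_cat; apply/orP; left; rewrite pE foldr_maxn //; apply/rawuP.
    exists (unzip1 z1), (unzip1 z2); split=> //.
      by rewrite all_predI okz1 le1.
    rewrite all_predI le2 okB // => f fz.
    by rewrite zE mem_cat inE fz !orbT.
  have {}s2 : subseq (unzip2 (e :: z2)) (map unshift B) by move: s2; rewrite /= en.
  exists (unzip1 z1 ++ map shift (unzip1 (e :: z2))).
    rewrite mem_cat; apply/orP; right; apply/rawsP.
    exists (unzip1 z1), (unzip1 (e :: z2)); split=> //.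
      by rewrite -zp zE /unzip1 map_cat.
    by apply: okB => // f fz; rewrite zE mem_cat fz orbT.
  by apply: occS => //; rewrite -zE.
- have splitA p1 p2 z : matching z -> unzip1 z = p1 ++ map shift p2 ->
      all (fun x => okl x.1) p1 -> all (fun x => okr x.1) p2 ->
      subseq (unzip2 z) u -> exists z1 z2,
      [/\ z = z1 ++ z2, unzip1 z1 = p1, unzip1 z2 = map shift p2,
          subseq (unzip2 z1) A & subseq (unzip2 z2) B].
    move=> mz /unzip1_catP[z1 [z2 [zE e1 e2]]] ok1 ok2.
    rewrite zE /unzip2 map_cat => szu.
    exists z1, z2; split=> //; rewrite subseq_filter; apply/andP; split.
    + apply/allP => x /mapP[f fz ->]; case: mz => <-; last by rewrite zE mem_cat fz.
      by move=> _; rewrite -oklE; move/allP: ok1; apply; rewrite -e1; apply: map_f.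
    + by apply: subseq_trans szu; rewrite prefix_subseq.
    + apply/allP => x /mapP[f fz ->].
      case: mz => <-; last by rewrite zE mem_cat fz orbT.
      move=> _; have : f.1 \in unzip1 z2 by apply: map_f.
      by rewrite e2 => /mapP[y yp ->]; apply: okr_shift; move/allP: ok2; apply.
    + by apply: subseq_trans szu; rewrite suffix_subseq.
  have unshM z1 z2 : matching (z1 ++ z2) ->
      matching (z1 ++ map (fun e => (unshift e.1, unshift e.2)) z2).
    by apply: matching_relabel => // x y; rewrite /unshift => ->.
  have mapK p2 : all (fun x => okr x.1) p2 -> map unshift (map shift p2) = p2.
    by move=> /allP ok; rewrite -map_comp map_id_in // => x /ok/shiftK.
  move=> [p' + [z [mz zp zu]]]; rewrite mem_cat.
  set m := foldr _ _ _ => /orP[/rawuP|/rawsP].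
    move=> [p1 [p2 [pE + + p'E]]]; rewrite !all_predI => /andP[ok1 m1] /andP[ok2 m2].
    have [|z1 [z2 [zE e1 e2 s1 s2]]] := splitA _ _ _ mz _ ok1 ok2 zu; first by rewrite zp.
    set z2' := map (fun e => (unshift e.1, unshift e.2)) z2.
    exists (z1 ++ ((i, m), (i, n)) :: z2'); split.
    + apply: matching_max => //=; first by apply: unshM; rewrite -zE.
      move=> f; rewrite mem_cat => /orP[fz|/mapP[g gz ->]] /=.
        split; first by move/allP: m1; apply; rewrite -e1 map_f.
        have /(mem_subseq s1) : f.2 \in unzip2 z1 by apply: map_f.
        by rewrite mem_filter => /andP[_ fu]; have /allP/(_ _ fu) := un.
      split.
        have : g.1 \in unzip1 z2 by apply: map_f.
        by rewrite e2 => /mapP[y yp ->]; rewrite /=; move/allP: m2; apply.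
      have /(mem_subseq s2) : g.2 \in unzip2 z2 by apply: map_f.
      by rewrite mem_filter => /andP[_ fu]; have /allP/(_ _ fu) := un.
    + by rewrite pE /unzip1 map_cat /= [map _ z1]e1 [map _ z2']unzip1_relabel e2 mapK.
    + by rewrite /unzip2 map_cat /= [map _ z2']unzip2_relabel; apply: cat_subseq;
        rewrite //= eqxx map_subseq.
  move=> [p1 [p2 [-> ok1 ok2 p'E]]].
  have [|z1 [z2 [zE e1 e2 s1 s2]]] := splitA _ _ _ mz _ ok1 ok2 zu; first by rewrite zp.
  exists (z1 ++ map (fun e => (unshift e.1, unshift e.2)) z2); split.
  + by apply: unshM; rewrite -zE.
  + by rewrite /unzip1 map_cat [map _ z1]e1 [X in _ ++ X]unzip1_relabel e2 mapK.
  + rewrite /unzip2 map_cat [X in subseq (_ ++ X) _]unzip2_relabel.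
    by apply: cat_subseq => //; apply: subseq_trans (subseq_cons _ _); apply: map_subseq.
Qed.
End Insertion.

(* Variants of has and all that stay lazy under vm_compute, where || and &&
   would evaluate both of their arguments. *)
Fixpoint hasl T (a : pred T) (s : seq T) : bool :=
  if s is x :: s' then (if a x then true else hasl a s') else false.

Fixpoint alll T (a : pred T) (s : seq T) : bool :=
  if s is x :: s' then (if a x then alll a s' else false) else true.

Lemma haslE T (a : pred T) s : hasl a s = has a s.
Proof. by elim: s => //= x s ->; case: (a x). Qed.

Lemma alllE T (a : pred T) s : alll a s = all a s.
Proof. by elim: s => //= x s ->; case: (a x). Qed.

(** * A sound test for occurrences *)

Definition same_cmp (c d : comparison) : bool :=
  match c, d with Eq, Eq | Lt, Lt | Gt, Gt => true | _, _ => false end.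

Lemma compareE m n : Nat.compare m n = if m < n then Lt else if n < m then Gt else Eq.
Proof. by elim: m n => [|m IHm] [|n] //=; rewrite IHm. Qed.

Lemma same_cmpE v w x y :
  same_cmp (Nat.compare v x) (Nat.compare w y) =
  ((v < x) == (w < y)) && ((x < v) == (y < w)).
Proof. by rewrite !compareE; case: (ltngtP v x); case: (ltngtP w y). Qed.

Fixpoint compat (v w : nat) (M : seq (nat * nat)) : bool :=
  if M is (x, y) :: M' then
    (if same_cmp (Nat.compare v x) (Nat.compare w y) then compat v w M' else false)
  else true.

(* M lists the pairs of values matched so far, and d is the number of letters of p
   that may still be skipped. *)
Fixpoint occ_in (M : seq (nat * nat)) (d : nat) (q p : word) {struct p} : bool :=
  if q is (a, v) :: q' then
    if p is (b, w) :: p' then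
      match Nat.compare a b with
      | Lt => false
      | Gt => if d is d'.+1 then occ_in M d' q p' else false
      | Eq =>
        if (if compat v w M then occ_in ((v, w) :: M) d q' p' else false) then true
        else if d is d'.+1 then occ_in M d' q p' else false
      end
    else false
  else true.

Definition occb (q p : word) : bool :=
  if Nat.leb (size q) (size p) then occ_in [::] (Nat.sub (size p) (size q)) q p
  else false.

Lemma compatP v w M : compat v w M ->
  {in M, forall m, (v < m.1) = (w < m.2) /\ (m.1 < v) = (m.2 < w)}.
Proof.
elim: M => // -[x y] M IHM /=; rewrite same_cmpE; case: ifP => // /andP[/eqP h1 /eqP h2].
by move=> /IHM h m; rewrite inE => /predU1P[->|/h].
Qed.

(** The last clause, comparing the rest of the match with the pairs already chosen, is what carries
    the induction. Giving up when the label in [p] has passed that in [q] relies on increasing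
    labels; it can lose occurrences but not invent any. *)
Lemma occ_in_sound M d q p : occ_in M d q p ->
  exists z, [/\ matching z, unzip1 z = q, subseq (unzip2 z) p &
    {in z, forall e, {in M, forall m,
       (e.1.2 < m.1) = (e.2.2 < m.2) /\ (m.1 < e.1.2) = (m.2 < e.2.2)}}].
Proof.
elim: p M d q => [|[b w] p IHp] M d [|[a v] q] //=; try by exists [::]; rewrite ?sub0seq.
have skip : (if d is d'.+1 then occ_in M d' ((a, v) :: q) p else false) ->
  exists z, [/\ matching z, unzip1 z = (a, v) :: q, subseq (unzip2 z) ((b, w) :: p) &
    {in z, forall e, {in M, forall m,
       (e.1.2 < m.1) = (e.2.2 < m.2) /\ (m.1 < e.1.2) = (m.2 < e.2.2)}}].
  case: d => // d /IHp[z [mz zq zp zM]]; exists z; split=> //.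
  exact: subseq_trans (subseq_cons _ _).
rewrite compareE; case: ltngtP => [_ //|_|ab]; first exact: skip.
case: ifP => [|_]; last exact: skip.
case: ifP => // /compatP vM /IHp[z [mz zq zp zM]] _.
exists (((a, v), (a, w)) :: z); split=> /=; rewrite -?ab ?zq ?eqxx //.
  have zvw e : e \in z -> (e.1.2 < v) = (e.2.2 < w) /\ (v < e.1.2) = (w < e.2.2).
    by move=> /zM/(_ (v, w)) /=; apply; rewrite inE eqxx.
  case: mz => m1 m2; split=> [e|e f]; rewrite !inE; first by case/predU1P => [->|/m1].
  case/predU1P => [->|ez]; case/predU1P => [->|fz] /=; rewrite ?ltnn //.
  - by case: (zvw _ fz).
  - by case: (zvw _ ez).
  - exact: m2.
move=> e; rewrite inE => /predU1P[->|ez] m mM /=; first exact: vM.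
by apply: zM => //; rewrite inE mM orbT.
Qed.

Lemma occb_sound q p : occb q p -> occurs q p.
Proof. by rewrite /occb; case: ifP => // _ /occ_in_sound[z [? ? ? _]]; exists z. Qed.

(** * Resolution on nonempty slots *)

Fixpoint insb (k h : nat) (p : word) : word :=
  let bump x := (x.1, if Nat.leb h x.2 then x.2.+1 else x.2) in
  if p is x :: p' then
    if Nat.leb x.1 k then bump x :: insb k h p' else (k, h) :: map bump p
  else [:: (k, h)].

Lemma lebE m n : Nat.leb m n = (m <= n).
Proof. by elim: m n => [|m IHm] [|n] //=; rewrite IHm. Qed.

Lemma insb_cat k h p1 p2 :
  all (fun x => x.1 <= k) p1 -> all (fun x => k < x.1) p2 ->
  insb k h (p1 ++ p2) =
  let bump x := (x.1, if h <= x.2 then x.2.+1 else x.2) in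
  map bump p1 ++ (k, h) :: map bump p2.
Proof.
have bE x : Nat.leb h x = (h <= x) by apply: lebE.
move=> + ok2; elim: p1 => [_|x p1 IHp1 /= /andP[xk /IHp1 ->]] /=.
  case: p2 ok2 => //= x p2 /andP[xk _]; rewrite lebE leqNgt xk /= bE; congr (_ :: _ :: _).
  by apply: eq_map => y; rewrite bE.
by rewrite lebE xk bE.
Qed.

Lemma bumpE h a b : ((if h <= a then a.+1 else a) < (if h <= b then b.+1 else b)) = (a < b).
Proof. by case: (leqP h a) => ha; case: (leqP h b) => hb; lia. Qed.

Lemma lt_bump h b : (h < (if h <= b then b.+1 else b)) = (h <= b).
Proof. by case: (leqP h b) => hb; lia. Qed.

(** The letter [(k, x)] of [u] can be added to the occurrence. Since [p] has no letter in the slot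
    [k], its place among the letters of [p] is forced, and only its rank is open: it is the least
    value or comes just above a value of [p]. *)
Lemma occurs_insb k x p u : sorted leq (unzip1 u) -> uniq (unzip2 u) ->
  (k, x) \in u -> all (fun y => y.1 != k) p -> occurs p u ->
  exists2 h, h \in 0 :: map (fun y => y.2.+1) p & occurs (insb k h p) u.
Proof.
move=> su uu ku pk [z [[m1 m2] zp zu]].
(* One more than the greatest pattern value matched below [x], or 0 if there is none. *)
pose h := \max_(e <- z | e.2.2 < x) e.1.2.+1.
have zx e : e \in z -> e.2.2 != x.
  move=> ez; apply/eqP => ex; have eu : e.2 \in u by apply: (mem_subseq zu); apply: map_f.
  have : e.2 = (k, x).
    apply/eqP; apply: contraT => ne.
    move: uu; rewrite (perm_uniq (perm_map _ (perm_to_rem ku))) /= => /andP[/negP xN _]; case: xN.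
    apply/mapP; exists e.2 => //.
    by have := eu; rewrite (perm_mem (perm_to_rem ku)) inE (negPf ne).
  move=> ekx; have := allP pk e.1; rewrite -zp map_f // => /(_ isT).
  by rewrite m1 // ekx eqxx.
have zh e : e \in z -> (h <= e.1.2) = (x < e.2.2).
  move=> ez; have ex := zx _ ez.
  apply/idP/idP => [he|xe].
    rewrite ltnNge leq_eqVlt (negPf ex) /=; apply: contraTN he => ltx.
    by rewrite -ltnNge /h (big_rem e) //= ltx leq_max leqnn.
  apply/bigmax_leqP_seq => f fz fx; rewrite m2 //; exact: ltn_trans fx xe.
exists h.
  have hP : h = 0 \/ exists2 e, e \in z & h = e.1.2.+1.
    rewrite /h big_seq_cond; elim/big_ind: _ => [|a b|e /andP[ez _]]; first by left.
    - by move=> [->|[e ez ->]] [->|[f fz ->]]; rewrite ?max0n ?maxn0; try (by left);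
        right; [exists f|exists e|case: (leqP e.1.2.+1 f.1.2.+1); [exists f|exists e]].
    - by right; exists e.
  rewrite inE; case: hP => [->//|[e ez ->]].
  by apply/orP; right; apply/mapP; exists e.1; rewrite // -zp map_f.
have sz : sorted leq (map (fun e => e.1.1) z).
  have -> : map (fun e => e.1.1) z = unzip1 (unzip2 z).
    by rewrite /unzip1 /unzip2 -map_comp; apply/eq_in_map => e /m1.
  by apply: (subseq_sorted leq_trans) su; apply: map_subseq.
set z1 := [seq e <- z | e.1.1 < k.+1]; set z2 := [seq e <- z | k < e.1.1].
have zE : z = z1 ++ z2 by rewrite [LHS](@sorted_split _ (fun e => e.1.1) z k.+1).
pose bump y := (y.1, if h <= y.2 then y.2.+1 else y.2) : nat * nat.
pose bz := map (fun e : (nat * nat) * (nat * nat) => (bump e.1, e.2)).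
have insE : insb k h p = unzip1 (bz z1 ++ ((k, h), (k, x)) :: bz z2).
  rewrite -zp [in LHS]zE /unzip1 map_cat insb_cat; last 2 first.
  - by apply/allP => y /mapP[e]; rewrite mem_filter => /andP[+ _] ->.
  - by apply/allP => y /mapP[e]; rewrite mem_filter => /andP[+ _] ->.
  by rewrite map_cat /= -!map_comp.
rewrite insE; exists (bz z1 ++ ((k, h), (k, x)) :: bz z2); split=> //.
- have emb e : e \in bz z1 ++ ((k, h), (k, x)) :: bz z2 ->
      e = ((k, h), (k, x)) \/ exists2 f, f \in z & e = (bump f.1, f.2).
    rewrite mem_cat inE orbCA => /predU1P[->|]; first by left.
    rewrite -mem_cat -map_cat -zE => /mapP[f fz ->]; right; by exists f.
  split=> [e|e f] /emb; first by case=> [->//|[f fz ->]] /=; apply: m1.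
  case=> [->|[e' ez ->]] /emb [->|[f' fz ->]]; rewrite /bump /= ?ltnn //.
  + by rewrite -(zh _ fz); apply: lt_bump.
  + have := zh _ ez; case: (ltngtP e'.2.2 x) (zx _ ez) => //= h2 _; case: (leqP h e'.1.2) => //= h1 _; lia.
  + by rewrite bumpE; apply: m2.
- rewrite /unzip2 map_cat /= -!map_comp /=.
  (* Cut [u] into the slots before [k], the slot [k], and the slots after it; [z] uses no letter of
     the middle piece, so [(k, x)] fits between. *)
  have uE : u = [seq y <- u | y.1 < k.+1] ++ [seq y <- u | k < y.1] by apply: sorted_split.
  have uE1 : [seq y <- u | y.1 < k.+1] = [seq y <- u | y.1 < k] ++ [seq y <- u | y.1 == k].
    have su1 : sorted leq (map fst [seq y <- u | y.1 < k.+1]).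
      by apply: (subseq_sorted leq_trans) su; apply: map_subseq; apply: filter_subseq.
    rewrite (sorted_split k su1) -!filter_predI; congr (_ ++ _); apply: eq_filter => y /=; lia.
  have zk e : e \in z -> e.2.1 != k.
    by move=> ez; rewrite -m1 //; apply: (allP pk); rewrite -zp map_f.
  have subz (a : pred _) : subseq (unzip2 [seq e <- z | a e]) u.
    by apply: subseq_trans zu; apply: map_subseq; apply: filter_subseq.
  rewrite uE uE1 -catA; apply: cat_subseq.
    rewrite subseq_filter subz andbT; apply/allP => y /mapP[e].
    rewrite mem_filter => /andP[h1 ez] ->; have := zk _ ez; move: h1.
    by rewrite m1 // ltnS leq_eqVlt => /orP[/eqP->|/= ->]; rewrite ?eqxx.
  rewrite -cat1s; apply: cat_subseq.
    by rewrite sub1seq mem_filter eqxx.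
  rewrite subseq_filter subz andbT; apply/allP => y /mapP[e].
  by rewrite mem_filter => /andP[h1 ez] -> /=; rewrite -m1.
Qed.

(* Resolution on the slots ks: if every way of adding to p a letter with the unused
   label k yields a consequence of Q, so is p, as the slot k is not empty. *)
Fixpoint imp (Q : seq word) (ks : seq nat) (p : word) : bool :=
  if hasl (fun q => occb q p) Q then true else
  if ks is k :: ks' then
    if hasl (fun x => eqn x.1 k) p then false
    else alll (fun h => imp Q ks' (insb k h p)) (0 :: map (fun x => x.2.+1) p)
  else false.

Lemma imp_sound Q ks p u : sorted leq (unzip1 u) -> uniq (unzip2 u) ->
  {subset ks <= unzip1 u} -> imp Q ks p -> occurs p u ->
  exists2 q, q \in Q & occurs q u.
Proof.
move=> su uu; elim: ks p => [|k ks IHks] p ksu.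
all: rewrite [imp _ _ _]/=; rewrite haslE; case: ifP => [/hasP[q qQ /occb_sound qp] _ pu|_].
- by exists q => //; apply: occurs_trans pu.
- by [].
- by exists q => //; apply: occurs_trans pu.
- rewrite haslE; case: ifP => // /negbT; rewrite -all_predC => kp.
  have ks1 : {subset ks <= unzip1 u} by move=> j jk; apply: ksu; rewrite inE jk orbT.
  have /mapP[[k' x] ku /= ek] : k \in unzip1 u by apply: ksu; rewrite inE eqxx.
  rewrite -ek in ku => impk pu.
  have [|h hp] := occurs_insb su uu ku _ pu.
    by apply: sub_all kp => y /=; rewrite eqnE.
  apply: IHks => //; move: impk; rewrite -/(alll _ (0 :: _)) alllE => /allP; exact.
Qed.

(** * Words obtained by inserting a new maximum *)

(* The first component of a letter is the index of its slot. *)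
Definition valid (n s : nat) (u : word) : bool :=
  [&& sorted leq (unzip1 u), all (fun k => k < s) (unzip1 u),
      all [in unzip1 u] (iota 0 s) & perm_eq (unzip2 u) (iota 0 n)].

(* The new maximum is inserted in the slot i; the flags tell whether letters of the
   slot remain on its left and on its right. *)
Definition move : Type := nat * bool * bool.

Definition moves (s : nat) : seq move :=
  flatten (map (fun i => [:: (i, false, false); (i, false, true);
                             (i, true, false); (i, true, true)]) (iota 0 s)).

Definition next (s : nat) (m : move) : nat := s.-1 + m.1.2 + m.2.

Definition insert (n : nat) (m : move) (u : word) : word :=
  build m.1.1 m.1.2 m.2 n u.

Fixpoint words (n s : nat) : seq word :=
  if n is n'.+1 then
    flatten [seq [seq insert n' m u | u <- words n' (next s m)] | m <- moves s]
  else if s is 0 then [:: [::]] else [::].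

Lemma mem_moves s m : (m \in moves s) = (m.1.1 < s).
Proof.
apply/flattenP/idP => [[_ /mapP[i] + ->]|ms].
  by rewrite mem_iota !inE => /andP[_ is_] /or4P[] /eqP ->.
exists [:: (m.1.1, false, false); (m.1.1, false, true);
           (m.1.1, true, false); (m.1.1, true, true)].
  by apply/mapP; exists m.1.1; rewrite ?mem_iota.
by case: m {ms} => -[i [] []]; rewrite !inE eqxx ?orbT.
Qed.

Lemma uniq_moves s : uniq (moves s).
Proof.
rewrite /moves; elim: s 0 => //= s IHs i; rewrite IHs !inE !xpair_eqE !eqxx /=.
have iN l r : (i, l, r) \notin flatten (map (fun i => [:: (i, false, false);
    (i, false, true); (i, true, false); (i, true, true)]) (iota i.+1 s)).
  apply/flattenP => -[_ /mapP[j + ->]]; rewrite mem_iota !inE !xpair_eqE.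
  by case: (i =P j) => //= ->; rewrite ltnn.
by rewrite !(negPf (iN _ _)).
Qed.

Lemma all_mem_iota s (t : seq nat) :
  reflect (forall k, k < s -> k \in t) (all [in t] (iota 0 s)).
Proof.
by apply: (iffP allP) => h k ks; [apply: h|apply: h; move: ks]; rewrite mem_iota.
Qed.

Lemma perm_iotaS n (s1 s2 : seq nat) :
  perm_eq (s1 ++ n :: s2) (iota 0 n.+1) = perm_eq (s1 ++ s2) (iota 0 n).
Proof.
rewrite -[n.+1]addn1 iotaD cats1 -cat1s perm_catCA /=.
by rewrite perm_sym perm_rcons perm_cons perm_sym.
Qed.

Lemma insert_valid n s m u : m.1.1 < s -> valid n (next s m) u -> valid n.+1 s (insert n m u).
Proof.
case: m => -[i l] r /=; rewrite /next /= => is_ /and4P[su ls /all_mem_iota cov pu].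
have l1 := leq_b1 l; have r1 := leq_b1 r.
rewrite /insert /=; set A := [seq x <- u | x.1 < i + l]; set B := [seq x <- u | i + l <= x.1].
have uE : u = A ++ B by apply: sorted_split.
have AP (x : nat * nat) : x \in A -> x.1 < i + l by rewrite mem_filter => /andP[].
have BP (x : nat * nat) : x \in B -> i + l <= x.1 /\ x.1 < s.-1 + l + r.
  rewrite mem_filter => /andP[-> xu]; split=> //; move/allP: ls; apply; exact: map_f.
have APi (x : nat * nat) : x \in A -> x.1 <= i by move/AP; lia.
have Us (x : nat * nat) : x \in B -> (unshift i l r x).1 < s.
  by move/BP; rewrite /unshift /=; case: ifP; lia.
have Umon (x y : nat * nat) : x \in B -> y \in B -> x.1 <= y.1 ->
    (unshift i l r x).1 <= (unshift i l r y).1.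
  by move=> /BP[xi _] /BP[yi _]; rewrite /unshift /=; case: ifP; case: ifP; lia.
have lE : unzip1 (build i l r n u) = unzip1 A ++ i :: map (fun x => (unshift i l r x).1) B.
  by rewrite /unzip1 map_cat /= -map_comp.
apply/and4P; split.
- rewrite lE (sorted_pairwise leq_trans) pairwise_cat /=.
  move: su; rewrite (sorted_pairwise leq_trans) uE /unzip1 map_cat pairwise_cat.
  move=> /and3P[_ pA pB]; rewrite pA; apply/and4P; split=> //.
  + apply/allrelP => _ y /mapP[x xA ->]; rewrite inE => /predU1P[->|/mapP[z /BP[zi _] ->]].
      exact: APi.
    exact: leq_trans (APi _ xA) (unshift_ge r zi).
  + by apply/allP => _ /mapP[z /BP[zi _] ->]; apply: unshift_ge.
  + rewrite pairwise_map; rewrite pairwise_map in pB.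
    apply: (@sub_in_pairwise _ [in B] _ _ _ B) pB; last exact/allP.
    by move=> x y xB yB; apply: Umon.
- rewrite lE all_cat /= is_ /=; apply/andP; split; apply/allP => _ /mapP[x xAB ->].
    exact: leq_ltn_trans (APi _ xAB) is_.
  exact: Us.
- apply/all_mem_iota => k ks; rewrite lE mem_cat inE.
  case: (ltngtP k i) => [ki|ki|->]; rewrite ?orbT //.
    have /mapP[x xu kx] : k \in unzip1 u by apply: cov; lia.
    by rewrite [k \in _](_ : _ = true) //; apply/mapP; exists x; rewrite // mem_filter xu -kx; lia.
  have /mapP[x xu kx] : k.-1 + l + r \in unzip1 u by apply: cov; lia.
  apply/orP; right; apply/orP; right; apply/mapP; exists x.
    by rewrite mem_filter xu -kx; lia.
  by rewrite /unshift /= -kx; case: ifP; lia.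
- rewrite /build -/A -/B /unzip2 map_cat map_cons -map_comp perm_iotaS.
  by move: pu; rewrite [in X in X -> _]uE /unzip2 map_cat.
Qed.

Lemma lt_next (a j s : nat) (l r : bool) : a < j + l -> j < s -> a < s.-1 + l + r.
Proof. by case: l r => [] []; lia. Qed.

(** The greatest letter is removed. The flags must record whether its slot survives on either side:
    only then do the new labels cover all slots of the remaining word. *)
Lemma insertP n s u : valid n.+1 s u ->
  exists m u', [/\ m.1.1 < s, valid n (next s m) u' & u = insert n m u'].
Proof.
move=> /and4P[su ls /all_mem_iota cov pu].
have /mapP[[i n'] xu /= en] : n \in unzip2 u by rewrite (perm_mem pu) mem_iota /=.
rewrite -{n'}en in xu; case/splitPr: xu su ls cov pu => A B.
rewrite /unzip1 /unzip2 !map_cat /= -/(unzip1 A) -/(unzip1 B) => su ls cov pu.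
pose l := i \in unzip1 A; pose r := i \in unzip1 B.
move: su; rewrite (sorted_pairwise leq_trans) pairwise_cat /=.
move=> /and4P[/allrelP rAB pA /allP iB pB].
have is_ : i < s by move: ls; rewrite all_cat /= => /and3P[].
have Ale (k : nat) : k \in unzip1 A -> k <= i by move=> kA; apply: (rAB k i kA); rewrite inE eqxx.
have Ai (x : nat * nat) : x \in A -> x.1 < i + l.
  move=> xA; have x1 : x.1 \in unzip1 A by apply: map_f.
  have := Ale _ x1; rewrite leq_eqVlt => /predU1P[e|xi]; last by rewrite ltn_addr.
  by rewrite /l -e x1 addn1.
have Bi (x : nat * nat) : x \in B -> okr i r x.1.
  move=> xB; have x1 : x.1 \in unzip1 B by apply: map_f.
  have := iB _ x1; rewrite leq_eqVlt okrE => /predU1P[e|->//].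
  by rewrite /r e x1 eqxx orbT.
have sB (x : nat * nat) : x \in B -> i + l <= (shift i l r x).1 by move=> /Bi/okr_shift.
have As (k : nat) : k \in unzip1 A ++ i :: unzip1 B -> k < s by move=> /(allP ls).
have Ss (x : nat * nat) : x \in B -> (shift i l r x).1 < s.-1 + l + r.
  move=> xB.
  by apply: shift_lt; [exact: Bi|apply: As; rewrite mem_cat inE (map_f _ xB : x.1 \in unzip1 B) !orbT].
have Smon (x y : nat * nat) : x \in B -> y \in B -> x.1 <= y.1 ->
    (shift i l r x).1 <= (shift i l r y).1.
  by move=> /Bi xi /Bi yi; apply: shift_mono.
exists (i, l, r), (A ++ map (shift i l r) B); split=> //; last first.
- rewrite /insert /build /= !filter_cat; congr (_ ++ _ :: _).
  + rewrite (all_filterP _); last exact/allP.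
    by rewrite filter_none ?cats0 //; apply/allP => _ /mapP[x /sB xB ->]; rewrite /= -leqNgt.
  + rewrite filter_none; last by apply/allP => x /Ai; rewrite /= ltnNge.
    rewrite (all_filterP _); last by apply/allP => _ /mapP[x /sB xB ->].
    by rewrite -map_comp map_id_in // => x xB; apply: (@shiftK i l r x (Bi x xB)).
have lE : unzip1 (A ++ map (shift i l r) B) = unzip1 A ++ map (fun x => (shift i l r x).1) B.
  by rewrite /unzip1 map_cat -map_comp.
apply/and4P; split.
- rewrite lE (sorted_pairwise leq_trans) pairwise_cat pA pairwise_map /=; apply/andP; split.
    apply/allrelP => _ _ /mapP[x xA ->] /mapP[y yB ->].
    exact: ltnW (leq_trans (Ai _ xA) (sB _ yB)).
  rewrite pairwise_map in pB.
  apply: (@sub_in_pairwise _ [in B] _ _ _ B) pB; last exact/allP.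
  by move=> x y xB yB; apply: Smon.
- rewrite lE all_cat; apply/andP; split; apply/allP => _ /mapP[x xA ->]; last exact: Ss.
  have x1 : x.1 \in unzip1 A by apply: map_f.
  by apply: lt_next is_; apply: Ai.
- apply/all_mem_iota => k; rewrite /next /= lE mem_cat => ks.
  have covB j : i < j -> j < s -> j.-1 + l + r \in map (fun x => (shift i l r x).1) B.
    move=> ij js; have := cov j js; rewrite mem_cat inE gtn_eqF //= => /orP[/Ale|/mapP[x xB jx]].
      by rewrite leqNgt ij.
    by apply/mapP; exists x => //; rewrite /shift -jx /= gtn_eqF.
  have covi : l -> i \in unzip1 A by [].
  have covr : r -> i + l \in map (fun x => (shift i l r x).1) B.
    by rewrite /r => /mapP[x xB ix]; apply/mapP; exists x => //; rewrite /shift -ix eqxx.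
  have covA j : j < i -> j \in unzip1 A.
    move=> ji; have := cov j (ltn_trans ji is_); rewrite mem_cat inE ltn_eqF //= => /orP[//|/iB].
    by rewrite leqNgt ji.
  (* A label [j] beyond the split slot comes from the slot [j.+1 - l - r] of the word before the
     removal. *)
  have {}covB j : i + l + r <= j -> j < s.-1 + l + r -> j \in map (fun x => (shift i l r x).1) B.
    move=> h1 h2; have := covB (j.+1 - l - r).
    have -> : (j.+1 - l - r).-1 + l + r = j by move: h1; clear; lia.
    by apply; move: h1 h2; clear; lia.
  case: (ltngtP k i) => ki; first by rewrite covA.
    have [h|h] := leqP (i + l + r) k; first by rewrite covB ?orbT.
    have [rt ->] : r /\ k = i + l by move: ki h; clear; case: (l) (r) => [] [] /=; lia.
    by rewrite covr ?orbT.
  rewrite ki; have [/covi ->//|/negPf lN] := orP (orbN l).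
  have lE0 : nat_of_bool l = 0 by rewrite lN.
  have [/covr|/negPf rN] := orP (orbN r); first by rewrite lE0 addn0 => ->; rewrite orbT.
  have rE0 : nat_of_bool r = 0 by rewrite rN.
  by rewrite covB ?orbT // -?ki // ki lE0 rE0 !addn0.
- rewrite /unzip2 map_cat -map_comp /=.
  by move: pu; rewrite perm_iotaS.
Qed.

Lemma cat_cons_inj (T : eqType) (a : pred T) (A A' B B' : seq T) x x' :
  all (predC a) A -> all (predC a) A' -> a x -> a x' ->
  A ++ x :: B = A' ++ x' :: B' -> [/\ A = A', x = x' & B = B'].
Proof.
elim: A A' => [|y A IHA] [|y' A'] /=.
- by move=> _ _ _ _ [-> ->].
- by move=> _ /andP[ay _] ax _ [xy]; rewrite -xy ax in ay.
- by move=> /andP[ay _] _ _ ax' [xy]; rewrite xy ax' in ay.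
- by move=> /andP[_ aA] /andP[_ aA'] ax ax' [-> /(IHA _ aA aA' ax ax')[-> -> ->]].
Qed.

Lemma valid_lt n s u : valid n s u -> all (fun x => x.2 < n) u.
Proof.
move=> /and4P[_ _ _ pu]; apply/allP => x xu.
have : x.2 \in unzip2 u by apply: map_f.
by rewrite (perm_mem pu) mem_iota.
Qed.

(* The flags of a move can be read off the word it produces: they tell whether
   the label of the new letter also occurs to its left, resp. right. *)
Lemma insert_flags n s m u : m.1.1 < s -> valid n (next s m) u ->
  [/\ m.1.2 = (m.1.1 \in unzip1 [seq x <- u | x.1 < m.1.1 + m.1.2]),
      m.2 = (m.1.1 \in unzip1 (map (unshift m.1.1 m.1.2 m.2) [seq x <- u | m.1.1 + m.1.2 <= x.1])) &
      map (shift m.1.1 m.1.2 m.2) (map (unshift m.1.1 m.1.2 m.2) [seq x <- u | m.1.1 + m.1.2 <= x.1])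
      = [seq x <- u | m.1.1 + m.1.2 <= x.1]].
Proof.
case: m => -[i l] r /= is_ /and4P[_ _ /all_mem_iota]; rewrite /next /= => cov _.
split; last first.
- by rewrite -map_comp map_id_in // => x; rewrite mem_filter => /andP[h _]; apply: unshiftK.
- case: r cov => cov; apply/esym.
    have /mapP[x xu ix] : i + l \in unzip1 u by apply: cov; lia.
    apply/mapP; exists (unshift i l true x).
      by apply: map_f; rewrite mem_filter xu -ix leqnn.
    by rewrite /unshift /= -ix eqxx.
  apply/negbTE/negP => /mapP[_ /mapP[x + ->]]; rewrite mem_filter => /andP[/unshift_okr h _].
  by have := h false; rewrite okrE orbF ltn_neqAle => /andP[/eqP].
- case: l cov => cov; apply/esym.
    have /mapP[x xu ix] : i \in unzip1 u by apply: cov; lia.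
    by apply/mapP; exists x; rewrite // mem_filter xu -ix addn1 leqnn.
  apply/negbTE/negP => /mapP[x]; rewrite mem_filter => /andP[+ _] ix.
  by rewrite -ix addn0 ltnn.
Qed.

(** The letter [n] occurs once, so the word determines its slot and both sides of the cut. The
    labels on the two sides give the flags, and the flags give [shift], which recovers [u]. *)
Lemma insert_inj n s m m' u u' : m.1.1 < s -> m'.1.1 < s ->
  valid n (next s m) u -> valid n (next s m') u' ->
  insert n m u = insert n m' u' -> m = m' /\ u = u'.
Proof.
move=> ms ms' vu vu'; have [fl fr fS] := insert_flags ms vu.
have [fl' fr' fS'] := insert_flags ms' vu'.
have [su su'] : sorted leq (unzip1 u) /\ sorted leq (unzip1 u').
  by case/and4P: vu; case/and4P: vu'.
have uE := sorted_split (m.1.1 + m.1.2) su; have uE' := sorted_split (m'.1.1 + m'.1.2) su'.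
have nA (v : word) a k : valid n k v ->
    all (predC (fun x : nat * nat => x.2 == n)) [seq x <- v | a x].
  move=> /valid_lt/allP lv; apply/allP => x; rewrite mem_filter => /andP[_ /lv].
  by rewrite /= ltn_neqAle => /andP[].
rewrite /insert /build => /(@cat_cons_inj _ (fun x : nat * nat => x.2 == n) _ _ _ _
  (m.1.1, n) (m'.1.1, n) (nA _ _ _ vu) (nA _ _ _ vu') (eqxx n) (eqxx n))[eA [ei] eB].
have el : m.1.2 = m'.1.2 by rewrite fl fl' eA ei.
have er : m.2 = m'.2 by rewrite fr fr' eB ei.
split; first by case: (m) (m') ei el er => [[? ?] ?] [[? ?] ?] /= -> -> ->.
by rewrite uE uE' -{}fS -{}fS' eA eB ei el er.
Qed.

Lemma mem_words n s u : (u \in words n s) = valid n s u.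
Proof.
elim: n s u => [|n IHn] s u.
  case: u => [|x u]; first by case: s.
  have -> : valid 0 s (x :: u) = false.
    by apply/negP => /and4P[_ _ _ /perm_size].
  by case: s.
apply/flattenP/idP => [[_ /mapP[m ms ->] /mapP[u' + ->]]|/insertP[m [u' [ms vu ->]]]].
  by rewrite IHn; rewrite mem_moves in ms; apply: insert_valid.
exists [seq insert n m u | u <- words n (next s m)].
  by apply/mapP; exists m; rewrite ?mem_moves.
by apply: map_f; rewrite IHn.
Qed.

Lemma uniq_words n s : uniq (words n s).
Proof.
elim: n s => [|n IHn] s; first by case: s.
apply: (@allpairs_uniq_dep _ _ _ (insert n) (moves s) (fun m => words n (next s m))).
- exact: uniq_moves.
- by move=> m _; apply: IHn.
move=> _ _ /allpairsPdep[m [u [ms us ->]]] /allpairsPdep[m' [u' [ms' us' ->]]] /=.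
rewrite !mem_moves in ms ms'; rewrite !mem_words in us us' *.
by case/(insert_inj ms ms' us us') => e; case: _ / e us' => _ ->.
Qed.

(** * Counting avoiders by removing the maximum *)

Definition avoid (Q : seq word) (u : word) : bool :=
  `[< forall q, q \in Q -> ~ occurs q u >].

Definition state : Type := nat * seq word.

Definition step (st : state) (m : move) : state :=
  (next st.1 m, flatten (map (raw m.1.1 m.1.2 m.2) st.2)).

Definition avoiders (n : nat) (st : state) : nat :=
  count (avoid st.2) (words n st.1).

Lemma avoid_insert n s m Q u : valid n (next s m) u ->
  avoid Q (insert n m u) = avoid (step (s, Q) m).2 u.
Proof.
move=> vu; have un := valid_lt vu; have su : sorted leq (unzip1 u) by case/and4P: vu.
apply: asbool_equiv_eq; split=> h q.
  move=> /flattenP[_ /mapP[p pQ ->] qp] qu; apply: (h p pQ).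
  by apply/(rawP _ _ _ _ su un); exists q.
move=> qQ /(rawP _ _ _ _ su un)[p pq pu]; apply: (h p) => //.
by apply/flattenP; exists (raw m.1.1 m.1.2 m.2 q) => //; apply: map_f.
Qed.

Lemma avoidersS n st :
  avoiders n.+1 st = \sum_(m <- moves st.1) avoiders n (step st m).
Proof.
rewrite /avoiders [words _ _]/= count_flatten -map_comp sumnE big_map.
apply: eq_bigr => m _ /=; rewrite count_map; apply: eq_in_count => u.
by rewrite mem_words => vu; case: st vu => s Q vu; apply: avoid_insert vu.
Qed.

(** * The automaton of sets of forbidden patterns *)

Definition missing (s : nat) (p : word) : seq nat :=
  [seq k <- iota 0 s | ~~ hasl (fun x => eqn x.1 k) p].

Fixpoint eqw (p q : word) : bool :=
  match p, q with
  | [::], [::] => true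
  | (a, v) :: p', (b, w) :: q' =>
    if eqn v w then (if eqn a b then eqw p' q' else false) else false
  | _, _ => false
  end.

Lemma eqwP p q : eqw p q -> p = q.
Proof.
elim: p q => [|[a v] p IHp] [|[b w] q] //=.
by case: eqnP => // ->; case: eqnP => // -> /IHp ->.
Qed.

Definition entails (Q : seq word) (s : nat) (p : word) : bool :=
  if hasl (eqw p) Q then true else imp Q (missing s p) p.

Lemma imp_words n s u Q ks p : u \in words n s -> {subset ks <= iota 0 s} ->
  imp Q ks p -> occurs p u -> exists2 q, q \in Q & occurs q u.
Proof.
rewrite mem_words => /and4P[su _ /allP cov pu] kss; apply: imp_sound => //.
  by rewrite (perm_uniq pu) iota_uniq.
by move=> k /kss/cov.
Qed.

Lemma entails_sound n s u Q p : u \in words n s -> entails Q s p -> avoid Q u ->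
  ~ occurs p u.
Proof.
move=> us ent /asboolP aQ pu.
suff [q qQ qu] : exists2 q, q \in Q & occurs q u by exact: (aQ q).
move: ent; rewrite /entails haslE; case: ifP => [/hasP[q qQ /eqwP pq] _|_].
  by exists q; rewrite // -pq.
by move/(imp_words us) => h; apply: h => // k; rewrite mem_filter => /andP[].
Qed.

(** Short patterns come first, so that searches succeed early. The forbidden permutations have at
    most 8 letters, and a step never lengthens a pattern. *)
Definition by_size (Q : seq word) : seq word :=
  flatten [seq [seq p : word <- Q | eqn (size p) k] | k <- iota 0 9].

Lemma by_size_sub Q : {subset by_size Q <= Q}.
Proof. by move=> p /flattenP[_ /mapP[k _ ->]]; rewrite mem_filter => /andP[]. Qed.

Lemma avoid_sub Q Q' u : {subset Q' <= Q} -> avoid Q u -> avoid Q' u.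
Proof. by move=> sQ /asboolP h; apply/asboolP => q /sQ; apply: h. Qed.

(** The empty pattern occurs in every word. If resolution on all slots shows that it entails a
    pattern of the state, then no word with these slots avoids them all. *)
Definition dead (st : state) : bool := imp (by_size st.2) (iota 0 st.1) [::].

Lemma dead_avoiders n st : dead st -> avoiders n st = 0.
Proof.
move=> dst; apply/eqP; rewrite /avoiders -leqn0 leqNgt -has_count; apply/hasPn => u us.
apply/negP => /asboolP au.
have [|q /by_size_sub qQ] := imp_words us (fun _ => id) dst; last exact: au.
by exists [::]; split; rewrite ?sub0seq.
Qed.

Definition equiv (st st' : state) : bool :=
  if eqn st.1 st'.1 then
    let Q := by_size st.2 in
    if alll (entails Q st.1) st'.2 then alll (entails st'.2 st.1) st.2 else false
  else false.

Lemma equiv_avoiders n st st' : equiv st st' -> avoiders n st = avoiders n st'.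
Proof.
case: st st' => [s Q] [s' Q']; rewrite /equiv /avoiders /=.
case: eqnP => // <-; case: ifP => //; rewrite !alllE => /allP QQ' /allP Q'Q.
apply: eq_in_count => u us; apply/idP/idP => au; apply/asboolP => q qQ.
  by apply: (entails_sound us (QQ' _ qQ)); apply: avoid_sub au; apply: by_size_sub.
exact: (entails_sound us (Q'Q _ qQ)).
Qed.

Definition st0 : state := (0, [::]).

(** * Verification of a transition table *)

Fixpoint row_ok (T : seq state) (st : state) (ms : seq move) (row : seq nat) : bool :=
  match ms with
  | [::] => if row is [::] then true else false
  | m :: ms' =>
    let st' := step st m in
    if dead st' then row_ok T st ms' row
    else if row is t :: row' then
      if equiv st' (nth st0 T t) then row_ok T st ms' row' else false
    else false
  end.

Lemma row_okP n T st ms row : row_ok T st ms row ->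
  \sum_(m <- ms) avoiders n (step st m) = \sum_(t <- row) avoiders n (nth st0 T t).
Proof.
elim: ms row => [|m ms IHms] row /=; first by case: row => // _; rewrite !big_nil.
rewrite big_cons; case: ifP => [/dead_avoiders -> /IHms -> //|_].
by case: row => // t row; case: ifP => // /equiv_avoiders -> /IHms ->; rewrite big_cons.
Qed.

Fixpoint minim (R Q : seq word) : seq word :=
  if Q is p :: Q' then
    minim (if hasl (fun r => occb r p) R then R else rcons R p) Q'
  else R.

Definition norm (st : state) : state := (st.1, minim [::] (by_size st.2)).

(* One entry per state: the index of an earlier state and the rank of the move
   that leads from it to this state, the hints to be added to the set of
   patterns obtained by this move, and the successors of the state for its moves
   that are not dead ends. *)
Definition cert : Type := seq (nat * nat * seq nat * seq nat).

Definition add_hints (hs : seq word) (xs : seq nat) (st : state) : state :=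
  (st.1, map (nth [::] hs) xs ++ st.2).

Definition start (B : seq (seq nat)) : state := (1, map (map (pair 0)) B).

(** Hints and [norm] only propose a set of patterns; each transition is tested afterwards by
    [equiv]. The head of [c] belongs to the start state, so only its row counts. *)
Definition table (hs : seq word) (B : seq (seq nat)) (c : cert) : seq state :=
  foldl (fun T e => let st := nth st0 T e.1.1.1 in
           rcons T (norm (add_hints hs e.1.2 (step st (nth (0, false, false) (moves st.1) e.1.1.2)))))
    [:: norm (start B)] (behead c).

Fixpoint rows_ok (T Ts : seq state) (c : cert) : bool :=
  match Ts, c with
  | [::], [::] => true
  | st :: Ts', (_, row) :: c' =>
    if row_ok T st (moves st.1) row then rows_ok T Ts' c' else false
  | _, _ => false
  end.

(** At length 0 there is only the empty word, which has no slots; it is counted by a state without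
    slots, provided that this state forbids nothing. *)
Definition final_ok (st : state) : bool :=
  if st is (0, _ :: _) then false else true.

Definition cert_ok (B : seq (seq nat)) (c : cert) (T : seq state) : bool :=
  let N := size T in
  if equiv (start B) (nth st0 T 0) then
    if alll (fun e : nat * nat * seq nat * seq nat => alll (fun t => Nat.leb t.+1 N) e.2) c then
      if alll final_ok T then rows_ok T T c else false
    else false
  else false.

Lemma rows_okP n T Ts c : rows_ok T Ts c -> size Ts = size c /\
  forall j, j < size c -> avoiders n.+1 (nth st0 Ts j) =
    \sum_(t <- nth [::] [seq e.2 | e <- c] j) avoiders n (nth st0 T t).
Proof.
elim: Ts c => [|st Ts IHTs] [|[e row] c] //=.
case: ifP => // /(row_okP n) rowE /IHTs[-> IH]; split=> // -[|j] /=; last exact: IH.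
by move=> _; rewrite avoidersS rowE.
Qed.

Lemma final_avoiders st : final_ok st -> avoiders 0 st = (st.1 == 0).
Proof.
case: st => -[|s] Q; rewrite /avoiders //=; case: Q => // _.
by have -> : avoid [::] [::] by exact/asboolP.
Qed.

(** * Permutations as words *)

Definition label0 : seq nat -> word := map (pair 0).

Definition oneline (n : nat) (w : 'S_n) : seq nat := [seq val (w i) | i <- enum 'I_n].

Lemma sorted_enum_ord n : sorted (relpre val ltn) (enum 'I_n).
Proof. by rewrite -sorted_map val_enum_ord iota_ltn_sorted. Qed.

Lemma subseq_map_enum_ord k n (f : 'I_k -> 'I_n) :
  (forall i j : 'I_k, i < j -> f i < f j) -> subseq (map f (enum 'I_k)) (enum 'I_n).
Proof.
move=> fmono; set s := map f _.
suff -> : s = [seq j <- enum 'I_n | j \in s] by apply: filter_subseq.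
apply: (@irr_sorted_eq _ (relpre val ltn)).
- by move=> x y z; apply: ltn_trans.
- by move=> x; apply: ltnn.
- by rewrite sorted_map; apply: sub_sorted (sorted_enum_ord k) => i j; apply: fmono.
- apply: sorted_filter (sorted_enum_ord n).
  by move=> x y z; apply: ltn_trans.
- by move=> j; rewrite mem_filter mem_enum andbT.
Qed.

Lemma map_nth_enum (p : seq nat) : [seq nth 0 p (i : 'I_(size p)) | i <- enum 'I_(size p)] = p.
Proof.
by rewrite -[RHS](mkseq_nth 0) /mkseq -val_enum_ord -map_comp.
Qed.

Lemma containsP n (w : 'S_n.+1) p :
  reflect (occurs (label0 p) (label0 (oneline w))) (contains w p).
Proof.
apply: (iffP existsP) => [[f /andP[/forallP fmono /forallP ford]]|].
- have {}fmono (i j : 'I_(size p)) : i < j -> f i < f j.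
    by move=> ij; have /forallP/(_ j)/implyP := fmono i; apply.
  have {}ford (i j : 'I_(size p)) : (w (f i) < w (f j)) = (nth 0 p i < nth 0 p j).
    by have /forallP/(_ j)/eqP := ford i.
  exists [seq ((0, nth 0 p (i : 'I_(size p))), (0, val (w (f i)))) | i <- enum 'I_(size p)]; split.
  + split=> [_ /mapP[i _ ->] //|_ _ /mapP[i _ ->] /mapP[j _ ->] /=].
    by rewrite ford.
  + by rewrite /unzip1 -map_comp -[in RHS](map_nth_enum p) /label0 -map_comp.
  + rewrite /unzip2 -map_comp /label0 /oneline -map_comp.
    rewrite (map_comp (pair 0 \o (fun i : 'I_n.+1 => val (w i))) f).
    by apply: map_subseq; apply: subseq_map_enum_ord.
- move=> [z [[m1 m2] zp]].
  rewrite /label0 /oneline -map_comp => /subseqP[m _]; rewrite -map_mask.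
  set J := mask m _ => zJ.
  have szJ : size J = size z by have := congr1 size zJ; rewrite !size_map.
  have szp : size z = size p by have := congr1 size zp; rewrite !size_map.
  have sJ : sorted (relpre val ltn) J.
    apply: (subseq_sorted _ (mask_subseq _ _)) (sorted_enum_ord n.+1).
    by move=> x y t; apply: ltn_trans.
  (* [J] lists the positions selected by the mask; the default [ord0] is why the permutation has
     size [n.+1]. *)
  exists [ffun i : 'I_(size p) => nth ord0 J i]; apply/andP; split.
    apply/forallP => i; apply/forallP => j; apply/implyP => ij; rewrite !ffunE.
    have tr : transitive (relpre (val : 'I_n.+1 -> nat) ltn).
      by move=> x y t; apply: ltn_trans.
    by apply: (sorted_ltn_nth tr ord0 sJ) => //; rewrite inE szJ szp.
  apply/forallP => i; apply/forallP => j; rewrite !ffunE eq_sym; apply/eqP.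
  pose e k := nth ((0, 0), (0, 0)) z k.
  have eE (k : 'I_(size p)) : (e k).1.2 = nth 0 p k /\ (e k).2.2 = w (nth ord0 J k).
    have kz : k < size z by rewrite szp.
    split.
      have := congr1 (fun s => (nth (0, 0) s k).2) zp.
      by rewrite (nth_map ((0, 0), (0, 0))) // (nth_map 0).
    have := congr1 (fun s => (nth (0, 0) s k).2) zJ.
    by rewrite (nth_map ((0, 0), (0, 0))) // (nth_map ord0) ?szJ.
  have [<- <-] := eE i; have [<- <-] := eE j.
  by apply: m2; rewrite mem_nth // szp.
Qed.

Lemma avoidsE n (w : 'S_n.+1) ps :
  avoids w ps = avoid (start ps).2 (label0 (oneline w)).
Proof.
apply/allP/asboolP => [h q /mapP[p pps ->] /containsP wp|h p pps].
  by have := h _ pps; rewrite wp.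
by apply/negP => /containsP; apply: h; apply: map_f.
Qed.

Lemma oneline_perm n (w : 'S_n) : perm_eq (oneline w) (iota 0 n).
Proof.
apply: uniq_perm; rewrite ?iota_uniq //.
  by rewrite map_inj_uniq ?enum_uniq // => i j /val_inj/perm_inj.
move=> k; rewrite mem_iota /=; apply/mapP/idP => [[i _ ->]|kn]; first exact: ltn_ord.
by exists (w^-1%g (Ordinal kn)); rewrite ?mem_enum // permKV.
Qed.

Lemma oneline_inj n : injective (@oneline n).
Proof.
move=> v w vw; apply/permP => i; apply: val_inj.
have /eq_in_map -> // := vw; exact: mem_enum.
Qed.

Lemma onelineP n s : perm_eq s (iota 0 n) -> exists w : 'S_n, oneline w = s.
Proof.
move=> ps; have sn : size s = n by rewrite (perm_size ps) size_iota.
have us : uniq s by rewrite (perm_uniq ps) iota_uniq.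
have lts (i : 'I_n) : nth 0 s i < n.
  have : nth 0 s i \in s by rewrite mem_nth // sn.
  by rewrite (perm_mem ps) mem_iota.
have finj : injective (fun i => Ordinal (lts i)).
  move=> i j /(congr1 val) /= /eqP; rewrite nth_uniq ?sn // => /eqP; exact: val_inj.
exists (perm finj); rewrite -[RHS]map_nth_enum sn; apply: eq_map => i.
by rewrite permE.
Qed.

Lemma unzip1_label0 s : unzip1 (label0 s) = nseq (size s) 0.
Proof. by elim: s => //= x s ->. Qed.

Lemma unzip2_label0 s : unzip2 (label0 s) = s.
Proof. by elim: s => //= x s ->. Qed.

(** With a single slot all labels are 0 and carry no information. The empty permutation is left out
    because a slot is never empty. *)
Lemma words1 n : perm_eq (words n.+1 1) (map (label0 \o @oneline n.+1) (enum 'S_n.+1)).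
Proof.
apply: uniq_perm; first exact: uniq_words.
  rewrite map_inj_uniq ?enum_uniq // => v w /= /(congr1 unzip2).
  by rewrite !unzip2_label0 => /oneline_inj.
move=> u; rewrite mem_words; apply/idP/mapP => [|[w _ ->]].
  move=> /and4P[_ /allP l0 _ /onelineP[w wu]]; exists w; rewrite ?mem_enum //=.
  rewrite wu /label0 /unzip2 -map_comp -[LHS]map_id; apply/eq_in_map => -[a v] av.
  have /l0 : a \in unzip1 u by apply/mapP; exists (a, v).
  by rewrite ltnS leqn0 => /eqP ->.
apply/and4P; split; rewrite /= ?unzip1_label0 ?unzip2_label0 ?oneline_perm //.
- by apply/(sortedP 0) => i; rewrite size_nseq => h; rewrite !nth_nseq !if_same.
- by apply/allP => k /nseqP[->].
- by rewrite size_map size_enum_ord inE eqxx.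
Qed.

Lemma card_avoids n ps : #|[set w : 'S_n.+1 | avoids w ps]| = avoiders n.+1 (start ps).
Proof.
rewrite /avoiders (seq.permP (words1 n)) count_map cardE -size_filter.
congr size; rewrite enumT; apply: eq_filter => w.
by apply: etrans (in_set _ _) _; apply: avoidsE.
Qed.

(** * The generating tree of maximally clustered permutations *)

Definition mc_patterns : seq (seq nat) :=
  [:: [:: 3; 4; 2; 1]; [:: 4; 3; 1; 2]; [:: 4; 3; 2; 1]].

Definition mc (s : seq nat) : bool := avoid (start mc_patterns).2 (label0 s).

(** The first clause covers the patterns 3421 and 4321, the second one 4312 and 4321. *)
Definition mc_quad (a b c d : nat) : bool :=
  [&& d < c, c < a & c < b] || [&& b < a, c < b & d < b].

Definition order_iso (p t : seq nat) : Prop := size p = size t /\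
  forall i j, i < size p -> j < size p ->
    (nth 0 p i < nth 0 p j) = (nth 0 t i < nth 0 t j).

Lemma occurs_label0 p s : occurs (label0 p) (label0 s) <->
  exists2 t, subseq t s & order_iso p t.
Proof.
split=> [[z [[_ m2] zp zs]]|[t ts [st H]]].
  have pE : p = unzip2 (unzip1 z) by rewrite zp unzip2_label0.
  exists (unzip2 (unzip2 z)); first by rewrite -[s]unzip2_label0; apply: map_subseq.
  split=> [|i j]; rewrite pE ?size_map // => iz jz.
  pose e := ((0, 0), (0, 0)); rewrite !(nth_map (0, 0)) ?size_map // !(nth_map e) //.
  by apply: m2; apply: mem_nth.
exists [seq ((0, nth 0 p i), (0, nth 0 t i)) | i <- iota 0 (size p)]; split.
- split=> [_ /mapP[i _ ->] //|_ _ /mapP[i + ->] /mapP[j + ->]] /=.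
  by rewrite !mem_iota; apply: H.
- by rewrite /unzip1 -map_comp -[in RHS](mkseq_nth 0 p) /label0 -map_comp.
- rewrite /unzip2 -map_comp st (map_comp (pair 0)) -/(label0 _).
  by apply: map_subseq; rewrite -/(mkseq _ _) mkseq_nth.
Qed.

Lemma mcP s : uniq s ->
  reflect (forall a b c d : nat, subseq [:: a; b; c; d] s -> ~~ mc_quad a b c d) (mc s).
Proof.
move=> us; apply: (iffP (asboolP _)) => [h a b c d ss|h _ /mapP[p pP ->]].
  have := subseq_uniq ss us; rewrite /= !inE !negb_or => /and4P[/and3P[ab _ _] _ cd _].
  rewrite -negb_or; apply: contraT; rewrite negbK => q; exfalso.
  have [p pm H] : exists2 p, p \in mc_patterns & order_iso p [:: a; b; c; d].
    move: q; case/orP => [/and3P[h1 h2 h3]|/and3P[h1 h2 h3]].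
      have [lt_ab|lt_ba] : a < b \/ b < a by lia.
        by exists [:: 3; 4; 2; 1] => //; split=> // -[|[|[|[|i]]]] // [|[|[|[|j]]]] // _ _ /=; lia.
      by exists [:: 4; 3; 2; 1] => //; split=> // -[|[|[|[|i]]]] // [|[|[|[|j]]]] // _ _ /=; lia.
    have [lt_cd|lt_dc] : c < d \/ d < c by lia.
      by exists [:: 4; 3; 1; 2] => //; split=> // -[|[|[|[|i]]]] // [|[|[|[|j]]]] // _ _ /=; lia.
    by exists [:: 4; 3; 2; 1] => //; split=> // -[|[|[|[|i]]]] // [|[|[|[|j]]]] // _ _ /=; lia.
  apply: (h _ (map_f _ pm)); apply/occurs_label0.
  by exists [:: a; b; c; d].
move=> /occurs_label0[t ts [st H]].
have sp : size p = 4 by move: pP; rewrite !inE => /or3P[] /eqP ->.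
case: t st ts H => [|a [|b [|c [|d [|]]]]]; rewrite sp // => _ ts H.
have := h _ _ _ _ ts; apply/negP; rewrite negbK /mc_quad.
have := H 1 0 isT isT; have := H 2 0 isT isT; have := H 2 1 isT isT.
have := H 3 2 isT isT; have := H 3 1 isT isT.
move: pP; rewrite !inE => /= pP <- <- <- <- <-.
by case/or3P: pP => /eqP ->.
Qed.

Lemma subseq_insert (T : eqType) (t A B : seq T) n : subseq t (A ++ n :: B) ->
  subseq t (A ++ B) \/
  exists t1 t2, [/\ t = t1 ++ n :: t2, subseq t1 A & subseq t2 B].
Proof.
move=> /subseq_catP[t1 [[|x t2] [-> s1 s2]]].
  by left; apply: cat_subseq => //; apply: sub0seq.
move: s2 => /=; case: eqP => [-> s2|_ s2]; last by left; apply: cat_subseq.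
by right; exists t1, t2.
Qed.

(* A cut of w into A ++ B is good when a new maximum may be inserted there. *)
Definition good (A B : seq nat) : Prop :=
  (forall x y z : nat, subseq [:: x; y; z] B -> ~~ ((y < x) && (z < x))) /\
  (forall a b c : nat, a \in A -> subseq [:: b; c] B -> ~~ ((c < b) && (b < a))).

Lemma mc_insert n A B : uniq (A ++ B) -> all (fun x => x < n) (A ++ B) ->
  mc (A ++ n :: B) <-> mc (A ++ B) /\ good A B.
Proof.
move=> uAB ltn_AB.
have n_max x : x \in A ++ B -> x < n by move/allP: ltn_AB; apply.
have uAnB : uniq (A ++ n :: B).
  rewrite -cat1s uniq_catCA cat1s /= uAB andbT; apply/negP => /n_max; by rewrite ltnn.
have lt1 t : subseq t A -> all (fun x => x < n) t.
  by move=> tA; apply/allP => x /(mem_subseq tA) xA; apply: n_max; rewrite mem_cat xA.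
have lt2 t : subseq t B -> all (fun x => x < n) t.
  by move=> tB; apply/allP => x /(mem_subseq tB) xB; apply: n_max; rewrite mem_cat xB orbT.
have sub1 a : a \in A -> subseq [:: a] A by rewrite sub1seq.
split=> [/(mcP uAnB) h|[/(mcP uAB) h [g1 g2]]].
  split; first apply/(mcP uAB).
    move=> a b c d ss; apply: h; apply: subseq_trans ss _.
    by apply: cat_subseq => //; apply: subseq_cons.
  split=> [x y z xyz|a b c aA bc].
    have := h n x y z; rewrite /mc_quad; have /andP[xn _] := lt2 _ xyz.
    have ss : subseq [:: n; x; y; z] (A ++ n :: B).
      by rewrite -[_ :: _]cat0s; apply: cat_subseq; rewrite ?sub0seq //= eqxx.
    by move=> /(_ ss); rewrite xn; lia.
  have := h a n b c; rewrite /mc_quad; have /andP[bn _] := lt2 _ bc.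
  have ss : subseq [:: a; n; b; c] (A ++ n :: B).
    by rewrite -cat1s; apply: cat_subseq; rewrite ?sub1 //= eqxx.
  by move=> /(_ ss); rewrite bn //; lia.
apply/(mcP uAnB) => a b c d /subseq_insert[/h //|[t1 [t2 [e s1 s2]]]].
have := lt1 _ s1; have := lt2 _ s2; rewrite /mc_quad.
case: t1 e s1 => [|x1 [|x2 [|x3 [|x4 [|x5 t1]]]]] //= [].
- by move=> -> e; rewrite -{}e in s2 *; have := g1 _ _ _ s2; rewrite /=; lia.
- move=> <- -> e; rewrite -{}e in s2 *; rewrite sub1seq => aA.
  by have := g2 a _ _ aA s2; rewrite /=; lia.
- by move=> <- <- -> e; rewrite -{}e in s2 * => _ /=; lia.
- by move=> <- <- <- -> e; rewrite -{}e in s2 * => _ /=; lia.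
Qed.

(* The label of w: the good cuts are those with at most m letters on the right,
   and the increasing suffixes are those with at most q letters. *)
Definition label (w : seq nat) (m q : nat) : Prop :=
  [/\ forall A B, w = A ++ B -> good A B <-> size B <= m,
      forall A B, w = A ++ B -> sorted ltn B = (size B <= q),
      q <= m & m <= size w].

Definition child (m q j : nat) : nat * nat :=
  match j with
  | 0 => (m.+1, q.+1)
  | 1 => (m.+1, 1)
  | _ => (minn j q, minn j q)
  end.

Lemma sorted_no_inversion B : uniq B ->
  (forall b c, subseq [:: b; c] B -> ~~ (c < b)) <-> sorted ltn B.
Proof.
move=> uB; rewrite (sorted_pairwise ltn_trans); split=> [h|pB b c bc].
  elim: B uB h => //= x B IHB /andP[xB uB] h; apply/andP; split.
    apply/allP => y yB; have := h x y; rewrite /= eqxx sub1seq => /(_ yB).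
    by rewrite -leqNgt leq_eqVlt => /predU1P[exy|//]; rewrite exy yB in xB.
  by apply: IHB => // b c bc; apply: h; apply: subseq_trans bc (subseq_cons _ _).
have := subseq_pairwise bc pB; rewrite /= => /andP[/andP[+ _] _].
by move/ltnW; rewrite leqNgt.
Qed.

Lemma cat_eq_cat (T : Type) (A B A' B' : seq T) : A ++ B = A' ++ B' ->
  size B' <= size B -> exists2 C, A' = A ++ C & B = C ++ B'.
Proof.
elim: A A' => [|x A IHA] [|x' A'] //=.
- by move=> -> _; exists [::].
- by move=> ->; exists (x' :: A').
- by move=> <- /=; rewrite size_cat ltnNge => h; exfalso; lia.
- by case=> -> /IHA h /h[C -> ->]; exists C.
Qed.

(** A cut to the right of [n] leaves a suffix of [B], and it is good exactly when this suffix is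
    increasing, since an inversion b > c after [n] makes [n], b, c forbidden. A cut to the left of
    [n] is bad if [B] has two letters, because [n] is followed by two smaller ones; otherwise [n]
    adds no obstruction, and the cut is as good as before, with one more letter on its right. An
    increasing suffix can contain [n] only if [B] is empty. *)
Lemma label_child n A B m q : uniq (A ++ B) -> all (fun x => x < n) (A ++ B) ->
  label (A ++ B) m q -> size B <= m ->
  label (A ++ n :: B) (child m q (size B)).1 (child m q (size B)).2.
Proof.
move=> uAB ltn_AB [goodP sortedP qm ms] Bm.
have lt_in x : x \in A ++ B -> x < n by move/allP: ltn_AB; apply.
have goodS A1 A2 B' : good A1 B' -> {subset A2 <= A1} -> good A2 B'.
  by case=> g1 g2 sA; split=> // a b c /sA; apply: g2.
have uB B1 B' : B = B1 ++ B' -> uniq B'.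
  by move=> eB; move: uAB; rewrite eB !cat_uniq => /and3P[_ _ /and3P[]].
have short A' B' : A ++ n :: B = A' ++ B' -> size B' <= size B ->
    exists2 B1, A' = A ++ n :: B1 & B = B1 ++ B'.
  move=> eAB sB; have [|[|x C] eA eB] := cat_eq_cat eAB; first exact: leqW.
    by move: sB; rewrite -[B']/([::] ++ B') -eB ltnn.
  by case: eB => nx eB; exists C; rewrite // eA nx.
have long A' B' : A ++ n :: B = A' ++ B' -> size B < size B' ->
    exists2 A2, A = A' ++ A2 & B' = A2 ++ n :: B.
  by move=> /esym eAB sB; have [//|C eA eB] := cat_eq_cat eAB; exists C.
have short_good A' B1 B' : A' = A ++ n :: B1 -> B = B1 ++ B' ->
    good A' B' <-> sorted ltn B'.
  move=> eA eB; rewrite -(sorted_no_inversion (uB _ _ eB)).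
  have g : good (A ++ B1) B'.
    apply/goodP; first by rewrite eB catA.
    by apply: leq_trans Bm; rewrite eB size_cat leq_addl.
  split=> [[_ g2] b c bc|h].
    have := g2 n b c; rewrite eA mem_cat inE eqxx orbT => /(_ isT bc).
    suff -> : b < n by rewrite andbT.
    by apply: lt_in; rewrite eB !mem_cat (mem_subseq bc) ?orbT // inE eqxx.
  case: g => g1 g2; split=> // a b c; rewrite eA mem_cat inE orbCA -mem_cat.
  case/predU1P => [_|aA] bc; last exact: g2.
  by have := h b c bc; apply: contra => /andP[].
have short_sorted B1 B' : B = B1 ++ B' -> sorted ltn B' = (size B' <= q).
  by move=> eB; apply: (sortedP (A ++ B1)); rewrite eB catA.
have long_sorted A2 : 0 < size B -> sorted ltn (A2 ++ n :: B) = false.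
  case: B {Bm ltn_AB uAB goodP sortedP ms uB short long short_good short_sorted} lt_in => // b B lt_in _.
  apply/negP => /(subseq_sorted ltn_trans (suffix_subseq _ _)) /= /andP[].
  by rewrite ltnNge ltnW // lt_in // mem_cat inE eqxx orbT.
have long_good A' A2 : A = A' ++ A2 -> size B <= 1 ->
    good A' (A2 ++ n :: B) <-> size A2 + size B <= m.
  move=> eA B1; rewrite -size_cat -(goodP A') ?eA ?catA //; split=> -[g1 g2].
    split=> [x y z s|a b c aA s]; [apply: (g1 x y z)|apply: (g2 a b c) => //];
    by apply: subseq_trans s _; apply: cat_subseq => //; apply: subseq_cons.
  have lt_in' (t : seq nat) : subseq t (A2 ++ B) -> all (fun x => x < n) t.
    move=> s; apply/allP => x /(mem_subseq s) xt; apply: lt_in.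
    by rewrite eA -catA mem_cat xt orbT.
  have ltA (t : seq nat) : subseq t A2 -> all (fun x => x < n) t.
    by move=> s; apply: lt_in'; apply: subseq_trans s (prefix_subseq _ _).
  have lenB (t : seq nat) : subseq t B -> size t <= 1.
    by move/size_subseq => h; apply: leq_trans B1.
  split=> [x y z|a b c aA] /subseq_insert[|[t1 [t2 [e s1 s2]]]].
  - exact: g1.
  - have := ltA _ s1; case: t1 e {s1} => [|x1 [|x2 [|x3 t1]]] //= [].
    + by move=> _ e; have := lenB _ s2; rewrite -e.
    + by move=> <- -> _ /= /andP[xn _]; rewrite ltnNge (ltnW xn).
    + by move=> <- <- -> _ /= /andP[xn _]; rewrite [n < x]ltnNge (ltnW xn) andbF.
    + by case: (t1).
  - exact: g2.
  - have an : a < n by apply: lt_in; rewrite eA !mem_cat aA.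
    have := ltA _ s1; case: t1 e {s1} => [|x1 [|x2 t1]] //= [].
    + by move=> -> _ _; rewrite [n < a]ltnNge (ltnW an) andbF.
    + by move=> <- -> _ /= /andP[bn _]; rewrite [n < b]ltnNge (ltnW bn).
    + by case: (t1).
have long_bad A' A2 : 1 < size B -> ~ good A' (A2 ++ n :: B).
  case: (B) lt_in => [|b [|c C]] //= lt_in _ [g1 _]; have := g1 n b c.
  have -> : subseq [:: n; b; c] (A2 ++ [:: n, b, c & C]).
    by rewrite -[_ :: _]cat0s; apply: cat_subseq; rewrite ?sub0seq //= !eqxx sub0seq.
  by move=> /(_ isT); rewrite !lt_in // mem_cat !inE eqxx !orbT.
(* A suffix of one letter is increasing; hence for [size B = 1] the bound min(1, q) is 1, as [child]
   has it. *)
have q_gt0 : 0 < size B -> 0 < q.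
  case/lastP: (B) sortedP => // B1 x /(_ (A ++ B1) [:: x]).
  by rewrite -cats1 catA => /(_ erefl) /= <-.
have szA : size (A ++ n :: B) = (size (A ++ B)).+1 by rewrite !size_cat addnS.
split.
- move=> A' B' eAB; case: (leqP (size B') (size B)) => sB.
    have [B1 eA eB] := short _ _ eAB sB.
    rewrite (short_good _ _ _ eA eB) (short_sorted _ _ eB).
    by case: (size B) sB Bm q_gt0 => [|[|k]] sB Bm /=; lia.
  have [A2 eA eB] := long _ _ eAB sB; rewrite eB.
  case: (leqP (size B) 1) => B1.
    rewrite (long_good _ _ eA B1) size_cat /=.
    by case: (size B) B1 => [|[|]] //= _; lia.
  split=> [/long_bad//|]; rewrite -eB.
  by case: (size B) B1 sB => [|[|k]] //=; lia.
- move=> A' B' eAB; case: (leqP (size B') (size B)) => sB.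
    have [B1 eA eB] := short _ _ eAB sB; rewrite (short_sorted _ _ eB).
    by case: (size B) sB q_gt0 => [|[|k]] sB /=; lia.
  have [A2 eA eB] := long _ _ eAB sB; rewrite eB.
  case: (posnP (size B)) => B0; last first.
    by rewrite long_sorted // -eB; case: (size B) sB B0 => [|[|k]] //=; lia.
  have eB0 : B = [::] by apply: size0nil.
  rewrite eB0 /= size_cat addn1 ltnS -(sortedP A') ?eA ?eB0 ?cats0 //.
  rewrite (sorted_pairwise ltn_trans) pairwise_cat /= andbT.
  rewrite -(sorted_pairwise ltn_trans) andbC; apply/andb_idr => _.
  apply/allrelP => x y xA; rewrite inE => /eqP ->; apply: lt_in.
  by rewrite eA !mem_cat xA orbT.
- by case: (size B) q_gt0 => [|[|k]] //=; lia.
- by rewrite szA; move: (size (A ++ B)) ms => N ms; case: (size B) Bm => [|[|k]] Bm /=; lia.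
Qed.

(** * Enumeration of permutations by insertions of maxima *)

Definition children (n : nat) (w : seq nat) : seq (seq nat) :=
  [seq take i w ++ n :: drop i w | i <- iota 0 n.+1].

Fixpoint insertions (n : nat) : seq (seq nat) :=
  if n is n'.+1 then flatten [seq children n' w | w <- insertions n'] else [:: [::]].

Lemma mem_insertions n s : (s \in insertions n) = perm_eq s (iota 0 n).
Proof.
elim: n s => [|n IHn] s; first by rewrite inE; apply/eqP/idP => [->//|/perm_nilP].
apply/flattenP/idP => [[_ /mapP[w + ->] /mapP[i _ ->]]|ps].
  by rewrite IHn perm_iotaS cat_take_drop.
have : n \in s by rewrite (perm_mem ps) mem_iota /=.
move: ps => /[swap] ns; case/splitPr: ns => A B; rewrite perm_iotaS -IHn => AB.
exists (children n (A ++ B)); first exact: map_f.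
apply/mapP; exists (size A); last by rewrite take_size_cat ?drop_size_cat.
rewrite mem_iota /= ltnS; move: AB; rewrite IHn => /perm_size.
by rewrite size_iota size_cat => <-; apply: leq_addr.
Qed.

Lemma perm_lt n s : perm_eq s (iota 0 n) -> all (fun x => x < n) s.
Proof. by move=> ps; apply/allP => x; rewrite (perm_mem ps) mem_iota. Qed.

Lemma uniq_insertions n : uniq (insertions n).
Proof.
elim: n => // n IHn.
apply: (@allpairs_uniq_dep _ _ _ (fun w i => take i w ++ n :: drop i w)) => //.
  by move=> w _; apply: iota_uniq.
move=> _ _ /allpairsPdep[w [i [win iin ->]]] /allpairsPdep[w' [i' [win' iin' ->]]] /= e.
rewrite !mem_insertions in win win'.
have nN v k : perm_eq v (iota 0 n) -> all (predC (pred1 n)) (take k v).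
  move=> /perm_lt lv; apply/allP => x /mem_take xv; move/allP/(_ _ xv): lv.
  by rewrite /= ltn_neqAle => /andP[].
have [et _ ed] := cat_cons_inj (nN _ i win) (nN _ i' win') (eqxx n) (eqxx n) e.
have ew : w = w' by rewrite -(cat_take_drop i w) et ed cat_take_drop.
have si v k : perm_eq v (iota 0 n) -> k \in iota 0 n.+1 -> size (take k v) = k.
  by rewrite mem_iota ltnS => /perm_size; rewrite size_iota => sv kn; rewrite size_takel ?sv.
by rewrite -ew -(si _ _ win iin) -(si _ _ win' iin') et.
Qed.

Fixpoint descendants (k n : nat) (w : seq nat) : nat :=
  if k is k'.+1 then \sum_(w' <- children n w) descendants k' n.+1 w' else mc w.

Lemma count_insertions k n :
  count mc (insertions (k + n)) = \sum_(w <- insertions n) descendants k n w.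
Proof.
elim: k n => [|k IHk] n; first by rewrite -sumn_count sumnE big_map.
by rewrite addSnnS IHk [insertions _.+1]/= big_flatten big_map.
Qed.

(* Number of descendants after k insertions of a word with label (m, q). *)
Fixpoint tree (k m q : nat) : nat :=
  if k is k'.+1 then \sum_(j < m.+1) tree k' (child m q j).1 (child m q j).2 else 1.

Lemma descendants_label k n w : perm_eq w (iota 0 n) ->
  (~~ mc w -> descendants k n w = 0) /\
  (mc w -> forall m q, label w m q -> descendants k n w = tree k m q).
Proof.
elim: k n w => [|k IHk] n w pw /=; first by case: (mc w).
have sw : size w = n by rewrite (perm_size pw) size_iota.
have uw : uniq w by rewrite (perm_uniq pw) iota_uniq.
have pc i : perm_eq (take i w ++ n :: drop i w) (iota 0 n.+1).
  by rewrite perm_iotaS cat_take_drop.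
have mcc i : mc (take i w ++ n :: drop i w) <-> mc w /\ good (take i w) (drop i w).
  by rewrite -[in X in _ <-> X /\ _](cat_take_drop i w); apply: mc_insert;
    rewrite cat_take_drop // perm_lt.
split=> [mw|mw m q lab].
  rewrite /children big_map big1 // => i _; have [+ _] := IHk _ _ (pc i); apply.
  by apply: contra mw => /mcc[].
have [goodP _ _ msz] := lab.
(* Reversing the index turns the position of the insertion into the number [j] of letters on its
   right. *)
rewrite /children big_map -/(index_iota 0 n.+1) big_mkord (reindex_inj rev_ord_inj) /=.
rewrite (eq_bigr (fun j : 'I_n.+1 => if j <= m then tree k (child m q j).1 (child m q j).2 else 0)).
  rewrite -big_mkcond /= (big_ord_widen n.+1 (fun j => tree k (child m q j).1 (child m q j).2)) //.
  by rewrite ltnS -sw.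
move=> j _; rewrite subSS; set i := n - j.
have sd : size (drop i w) = j by rewrite size_drop sw subKn // -ltnS.
have wE := esym (cat_take_drop i w).
have [IH0 IH1] := IHk _ _ (pc i).
case: ifP => jm.
  have gd : good (take i w) (drop i w) by apply/(goodP _ _ wE); rewrite sd.
  apply: IH1; first by apply/mcc.
  rewrite -sd; apply: label_child; rewrite ?cat_take_drop ?sd ?perm_lt //.
apply: IH0; apply/negP => /mcc[_ /(goodP _ _ wE)]; by rewrite sd jm.
Qed.

Lemma card_maximally_clustered n :
  #|[set w : 'S_n.+1 | maximally_clustered w]| = tree n 1 1.
Proof.
have -> : #|[set w : 'S_n.+1 | maximally_clustered w]| = count mc (insertions n.+1).
  have p1 : perm_eq (insertions n.+1) (map (@oneline n.+1) (enum 'S_n.+1)).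
    apply: uniq_perm; first exact: uniq_insertions.
      by rewrite map_inj_uniq ?enum_uniq //; apply: oneline_inj.
    move=> s; rewrite mem_insertions; apply/idP/mapP => [/onelineP[w <-]|[w _ ->]].
      by exists w; rewrite ?mem_enum.
    exact: oneline_perm.
  rewrite (seq.permP p1) count_map cardE -size_filter.
  congr size; rewrite enumT; apply: eq_filter => w.
  by apply: etrans (in_set _ _) _; apply: avoidsE.
rewrite -[n.+1]addn1 count_insertions /= big_seq1.
have mc0 : mc [:: 0] by apply/(@mcP [:: 0] isT) => a b c d /size_subseq.
have lab0 : label [:: 0] 1 1.
  split=> // [[|a A] B|[|a A] B] //=.
  - by move=> <-; split=> // _; split=> [x y z /size_subseq|].
  - case=> _; case: A B => [|//] [|//] _; split=> // _.
  - by move=> <-.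
  - by case=> _; case: A B => [|//] [|//].
by have [_ /(_ mc0 _ _ lab0)] := @descendants_label n 1 [:: 0] isT.
Qed.

(** * Certificates *)

(* Consequences of the forbidden patterns of some states, which keep their sets of
   patterns small. *)
Definition hints : seq word := [:: [:: (0, 1); (0, 2)];
[:: (0, 2); (2, 1)];
[:: (0, 2); (3, 1)];
[:: (0, 2); (4, 1)];
[:: (1, 1); (1, 2)];
[:: (1, 2); (3, 1)];
[:: (0, 2); (0, 3); (4, 1)];
[:: (0, 3); (0, 2); (2, 1)];
[:: (0, 3); (0, 2); (3, 1)];
[:: (0, 3); (2, 1); (2, 2)];
[:: (0, 3); (3, 1); (3, 2)];
[:: (0, 2); (0, 4); (3, 1); (3, 3)];
[:: (0, 2); (0, 4); (3, 1); (4, 3)];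
[:: (0, 3); (0, 4); (3, 1); (3, 2)];
[:: (0, 4); (1, 1); (1, 2); (1, 3)];
[:: (0, 4); (1, 1); (1, 2); (2, 3)];
[:: (0, 4); (2, 1); (2, 2); (2, 3)];
[:: (0, 4); (2, 1); (2, 2); (3, 3)];
[:: (0, 3); (0, 4); (0, 5); (0, 1); (3, 2)];
[:: (0, 3); (0, 5); (2, 1); (2, 2); (2, 4)];
[:: (0, 3); (0, 5); (2, 1); (2, 2); (3, 4)];
[:: (0, 3); (0, 5); (2, 1); (2, 2); (4, 4)];
[:: (0, 4); (0, 5); (2, 1); (2, 2); (2, 3)];
[:: (0, 4); (0, 5); (2, 1); (2, 2); (3, 3)];
[:: (0, 3); (0, 5); (0, 6); (0, 1); (2, 2); (2, 4)];
[:: (0, 3); (0, 5); (0, 6); (0, 1); (2, 2); (3, 4)];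
[:: (0, 4); (0, 5); (0, 6); (0, 1); (2, 2); (2, 3)];
[:: (0, 4); (0, 5); (0, 6); (1, 1); (1, 2); (3, 3)];
[:: (0, 4); (0, 5); (0, 6); (0, 1); (0, 7); (0, 2); (2, 3)];
[:: (0, 4); (0, 5); (0, 6); (0, 7); (0, 1); (0, 2); (2, 3)]].
(** There are 100 states. State 0 is the start; state 1 has no slots and is reached when the last
    letter is removed. *)
Definition mc_cert : cert := [::
(0, 0, [::], [::1;2;0;3]);
(0, 0, [::], [::]);
(0, 1, [::], [::1;4;2;5]);
(0, 3, [::], [::6;7;8;46;0;9;3;10]);
(2, 1, [::], [::1]);
(2, 3, [::], [::4;5;2]);
(3, 0, [::], [::1;6]);
(3, 1, [::], [::4;5;2;7]);
(3, 2, [::], [::6;7;11;51;0;8]);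
(3, 5, [::], [::4;5;9;10;0]);
(3, 7, [::], [::12;20;24;75;9;10;3]);
(8, 2, [::], [::13;14;15;57;0;16]);
(10, 0, [::], [::6]);
(11, 0, [::], [::1;17]);
(11, 1, [::], [::4;5;2;18]);
(11, 2, [::], [::13;14;15;57;0;19]);
(11, 6, [::], [::17;18;19;21;0;16]);
(13, 2, [::], [::1;4]);
(14, 6, [::], [::4;5;2;5]);
(15, 6, [::], [::17;18;19;21;0;9]);
(10, 1, [::1], [::7]);
(16, 3, [::], [::22;23;29;89;9;10;3;10]);
(21, 0, [::], [::6;12]);
(21, 1, [::1], [::7;20]);
(10, 2, [::7], [::12;20;25;67;8]);
(24, 2, [::14], [::26;27;28;63;16]);
(25, 0, [::], [::17]);
(25, 1, [::], [::18]);
(25, 2, [::], [::26;27;28;63;19]);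
(21, 2, [::7], [::22;23;30;74;8;24]);
(29, 2, [::14], [::31;32;33;68;16;34]);
(30, 0, [::], [::17;35]);
(30, 1, [::], [::18;36]);
(30, 2, [::], [::31;32;33;68;19;37]);
(30, 10, [::], [::35;36;37;38;16]);
(31, 6, [::0], [::4]);
(32, 10, [::4], [::5]);
(33, 10, [::4], [::35;36;37;38;9]);
(37, 3, [::18], [::39;40;41;90;10]);
(38, 0, [::], [::12]);
(38, 1, [::1], [::20]);
(38, 2, [::7], [::39;40;42;72;24]);
(41, 2, [::15;14], [::43;44;45;58;34]);
(42, 0, [::0], [::35]);
(42, 1, [::4], [::36]);
(42, 2, [::4], [::43;44;45;58;37]);
(3, 3, [::19;22], [::47;48;49;81;9;10;3;46]);
(46, 0, [::], [::6;47]);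
(46, 1, [::1], [::7;48]);
(46, 2, [::7], [::22;23;30;74;8;50]);
(49, 10, [::], [::12;20;25;67;8;50]);
(8, 3, [::19;22], [::52;54;55;87;9;10;3;53]);
(51, 0, [::], [::6;22]);
(51, 10, [::], [::22;23;29;89;9;10;3;53]);
(51, 1, [::1], [::7;23]);
(51, 2, [::7], [::22;23;30;74;8;56]);
(55, 10, [::], [::12;20;25;67;8;24]);
(11, 3, [::19;22], [::52;54;55;87;9;10;3;21]);
(45, 3, [::6;12;18], [::59;60;61;79;38]);
(58, 0, [::], [::39]);
(58, 1, [::1], [::40]);
(58, 2, [::2;7], [::62]);
(61, 16, [::], [::24]);
(25, 3, [::18;20;23], [::64;65;66;99;21]);
(63, 0, [::], [::22]);
(63, 1, [::1], [::23]);
(63, 2, [::9;7], [::39;40;42;72;56]);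
(24, 3, [::16;18;20;23], [::64;65;66;99;53]);
(30, 3, [::11;13;18;20;23], [::69;70;71;98;21;38]);
(68, 0, [::], [::22;39]);
(68, 1, [::1], [::23;40]);
(68, 2, [::9;7], [::39;40;42;72;56;62]);
(71, 3, [::6;12;17;16;18], [::59;60;61;79;73]);
(72, 16, [::], [::39;40;41;90;53]);
(49, 3, [::11;13;16;18;20;23], [::69;70;71;98;53;73]);
(10, 3, [::5;8;18;20;19;23;22], [::76;77;78;97;46]);
(75, 0, [::], [::47]);
(75, 1, [::1], [::48]);
(75, 2, [::9;7], [::39;40;42;72;50]);
(58, 3, [::5;3;8;18;20;19;23;22], [::80]);
(79, 20, [::], [::75]);
(46, 3, [::5;8;11;13;18;20;19;23;22], [::82;84;85;96;46;83]);
(81, 0, [::], [::47;76]);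
(81, 14, [::], [::76;77;78;97;46;83]);
(81, 1, [::1], [::48;77]);
(81, 2, [::9;7], [::39;40;42;72;50;86]);
(85, 14, [::], [::50]);
(51, 3, [::5;8;11;13;18;20;19;23;22], [::82;84;85;96;46;88]);
(87, 14, [::], [::76;77;78;97;46;75]);
(53, 3, [::5;8;11;13;18;20;19;23;22], [::82;84;85;96;46;75]);
(38, 3, [::5;6;8;12;18;21;20;19;23;22], [::91;92;93;94;75]);
(90, 0, [::], [::76]);
(90, 1, [::1], [::77]);
(90, 2, [::2;9;7], [::86]);
(90, 3, [::5;3;10;8;18;20;19;23;22], [::95]);
(94, 20, [::], [::83]);
(81, 3, [::5;6;10;8;12;18;21;20;19;23;22], [::91;92;93;94;83;95]);
(75, 3, [::5;6;10;8;12;18;21;20;19;23;22], [::91;92;93;94;83]);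
(74, 3, [::5;6;10;8;12;18;21;20;19;23;22], [::91;92;93;94;88;80]);
(67, 3, [::5;6;10;8;12;18;21;20;19;23;22], [::91;92;93;94;88])].
Definition fb_cert : cert := [::
(0, 0, [::], [::1;2;0;3]);
(0, 0, [::], [::]);
(0, 1, [::], [::1;4;2;5]);
(0, 3, [::], [::6;7;8;48;0;9;3;25]);
(2, 1, [::], [::1]);
(2, 3, [::], [::2]);
(3, 0, [::], [::1;6]);
(3, 1, [::], [::4;5;2;7]);
(3, 2, [::], [::6;7;10;53;0;8]);
(3, 5, [::], [::4;11;9;12;0]);
(8, 2, [::], [::14;15;16;59;0;17]);
(9, 1, [::], [::4;5;2]);
(9, 3, [::], [::13;21;26;70;9;25;3]);
(12, 0, [::], [::6]);
(10, 0, [::], [::1;18]);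
(10, 1, [::], [::4;5;2;19]);
(10, 2, [::], [::14;15;16;59;0;20]);
(10, 6, [::], [::18;19;20;22;0;17]);
(14, 2, [::], [::1;4]);
(15, 6, [::], [::4;5;2;11]);
(16, 6, [::], [::18;19;20;22;0;9]);
(12, 1, [::1], [::7]);
(17, 3, [::], [::23;24;31;91;9;25;3;12]);
(22, 0, [::], [::6;13]);
(22, 1, [::1], [::7;21]);
(3, 7, [::7], [::13;21;26;70;3]);
(25, 2, [::], [::13;21;27;69;8]);
(26, 2, [::14], [::28;29;30;65;17]);
(27, 0, [::], [::18]);
(27, 1, [::], [::19]);
(27, 2, [::], [::28;29;30;65;20]);
(22, 2, [::7], [::23;24;32;80;8;26]);
(31, 2, [::14], [::33;34;35;74;17;36]);
(32, 0, [::], [::18;37]);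
(32, 1, [::], [::19;38]);
(32, 2, [::], [::33;34;35;74;20;39]);
(32, 10, [::], [::37;38;39;40;17]);
(33, 6, [::0], [::4]);
(34, 10, [::4], [::11]);
(35, 10, [::4], [::37;38;39;40;9]);
(39, 3, [::18], [::41;42;43;92;12]);
(40, 0, [::], [::13]);
(40, 1, [::1], [::21]);
(40, 2, [::7], [::41;42;44;78;26]);
(43, 2, [::15;14], [::45;46;47;60;36]);
(44, 0, [::0], [::37]);
(44, 1, [::4], [::38]);
(44, 2, [::4], [::45;46;47;60;39]);
(3, 3, [::19;22], [::49;50;51;83;9;25;3;48]);
(48, 0, [::], [::6;49]);
(48, 1, [::1], [::7;50]);
(48, 2, [::7], [::23;24;32;80;8;52]);
(51, 10, [::], [::13;21;27;69;8;52]);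
(8, 3, [::19;22], [::54;56;57;89;9;25;3;55]);
(53, 0, [::], [::6;23]);
(53, 10, [::], [::23;24;31;91;9;25;3;55]);
(53, 1, [::1], [::7;24]);
(53, 2, [::7], [::23;24;32;80;8;58]);
(57, 10, [::], [::13;21;27;69;8;26]);
(10, 3, [::19;22], [::54;56;57;89;9;25;3;22]);
(47, 3, [::6;12;18], [::61;62;63;81;40]);
(60, 0, [::], [::41]);
(60, 1, [::1], [::42]);
(60, 2, [::2;7], [::64]);
(63, 16, [::], [::26]);
(27, 3, [::18;20;23], [::66;67;68;101;22]);
(65, 0, [::], [::23]);
(65, 1, [::1], [::24]);
(65, 2, [::9;7], [::41;42;44;78;58]);
(26, 3, [::16;18;20;23], [::66;67;68;101;55]);
(25, 3, [::18;20;19;23;22], [::71;72;73;99;48]);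
(70, 0, [::], [::49]);
(70, 1, [::1], [::50]);
(70, 2, [::9;7], [::41;42;44;78;52]);
(32, 3, [::11;13;18;20;23], [::75;76;77;100;22;40]);
(74, 0, [::], [::23;41]);
(74, 1, [::1], [::24;42]);
(74, 2, [::9;7], [::41;42;44;78;58;64]);
(73, 3, [::6;12;17;16;18], [::61;62;63;81;79]);
(78, 16, [::], [::41;42;43;92;55]);
(51, 3, [::11;13;16;18;20;23], [::75;76;77;100;55;79]);
(60, 3, [::5;3;8;18;20;19;23;22], [::82]);
(81, 20, [::], [::70]);
(48, 3, [::5;8;11;13;18;20;19;23;22], [::84;86;87;98;48;85]);
(83, 0, [::], [::49;71]);
(83, 14, [::], [::71;72;73;99;48;85]);
(83, 1, [::1], [::50;72]);
(83, 2, [::9;7], [::41;42;44;78;52;88]);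
(87, 14, [::], [::52]);
(53, 3, [::5;8;11;13;18;20;19;23;22], [::84;86;87;98;48;90]);
(89, 14, [::], [::71;72;73;99;48;70]);
(55, 3, [::5;8;11;13;18;20;19;23;22], [::84;86;87;98;48;70]);
(40, 3, [::5;6;8;12;18;21;20;19;23;22], [::93;94;95;96;70]);
(92, 0, [::], [::71]);
(92, 1, [::1], [::72]);
(92, 2, [::2;9;7], [::88]);
(92, 3, [::5;3;10;8;18;20;19;23;22], [::97]);
(96, 20, [::], [::85]);
(83, 3, [::5;6;10;8;12;18;21;20;19;23;22], [::93;94;95;96;85;97]);
(70, 3, [::5;6;10;8;12;18;21;20;19;23;22], [::93;94;95;96;85]);
(80, 3, [::5;6;10;8;12;18;21;20;19;23;22], [::93;94;95;96;90;82]);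
(69, 3, [::5;6;10;8;12;18;21;20;19;23;22], [::93;94;95;96;90])].

Definition hexagons : seq (seq nat) :=
  [:: [:: 4; 6; 7; 1; 8; 2; 3; 5]; [:: 4; 6; 7; 8; 1; 2; 3; 5];
      [:: 5; 6; 7; 1; 8; 2; 3; 4]; [:: 5; 6; 7; 8; 1; 2; 3; 4]].

Local Open Scope ring_scope.

(** * Linear recurrences *)

Section Linear.
Variables (R : comNzRingType) (rows : seq (seq nat)).

Definition vnext (V : seq R) : seq R :=
  [seq foldr (fun t => +%R V`_t) 0 row | row <- rows].

Definition vadd (V W : seq R) : seq R := [seq x.1 + x.2 | x <- zip V W].

(** The polynomial with coefficients [c], lowest degree first, evaluated at the transition matrix
    and applied to [V]. *)
Fixpoint vcomb (c : seq R) (V : seq R) : seq R :=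
  if c is a :: c' then vadd (map ( *%R a) V) (vcomb c' (vnext V))
  else nseq (size V) 0.

Hypothesis rows_lt : all (all (fun t => (t < size rows)%N)) rows.

Definition linear_system (u : nat -> nat -> R) : Prop :=
  forall n j, (j < size rows)%N -> u n.+1 j = \sum_(t <- nth [::] rows j) u n t.

Definition represents (V : seq R) (v : nat -> R) : Prop :=
  size V = size rows /\ forall j, (j < size rows)%N -> V`_j = v j.

Definition shifts (c : seq R) (u : nat -> R) (n : nat) : R :=
  \sum_(k < size c) c`_k * u (n + k)%N.

Lemma shifts_cons a c u n : shifts (a :: c) u n = a * u n + shifts c u n.+1.
Proof.
rewrite /shifts big_ord_recl addn0; congr (_ + _).
by apply: eq_bigr => k _; rewrite /bump /= addSnnS.
Qed.

(** Shifting the length commutes with the transition matrix, so a combination of shifts with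
    constant coefficients solves the same system. *)
Lemma linear_shifts c u : linear_system u ->
  linear_system (fun n j => shifts c (u^~ j) n).
Proof.
move=> lu n j jN; rewrite /shifts exchange_big /=; apply: eq_bigr => k _.
by rewrite addSn lu // mulr_sumr.
Qed.

Lemma vnext_represents u n V : linear_system u ->
  represents V (u n) -> represents (vnext V) (u n.+1).
Proof.
move=> lu [sV Vu]; split=> [|j jN]; first by rewrite size_map.
rewrite (nth_map [::]) // lu //.
have /all_nthP/(_ j jN) := rows_lt => /(_ [::]).
elim: (nth _ _ j) => [|t row IH] /=; first by rewrite big_nil.
by move=> /andP[tN /IH ->]; rewrite big_cons Vu.
Qed.

Lemma vcomb_represents c u n V : linear_system u ->
  represents V (u n) -> represents (vcomb c V) (fun j => shifts c (u^~ j) n).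
Proof.
move=> lu; elim: c n V => [|a c IHc] n V rV.
  case: rV => sV _; split=> [|j jN]; first by rewrite size_nseq.
  by rewrite nth_nseq sV jN /shifts big_ord0.
have [sC Cu] := IHc _ _ (vnext_represents lu rV).
case: rV => sV Vu; rewrite [vcomb _ _]/=; split=> [|j jN].
  by rewrite size_map size_zip sC size_map sV minnn.
rewrite (nth_map (0, 0)) ?size_zip ?sC ?size_map ?sV ?minnn //.
rewrite nth_zip ?sC ?size_map //= (nth_map 0) ?sV // Cu // Vu //.
by rewrite shifts_cons.
Qed.

Lemma linear_eq0 u n : linear_system u ->
  represents (nseq (size rows) 0) (u n) ->
  forall k j, (j < size rows)%N -> u (n + k)%N j = 0.
Proof.
move=> lu [_ un]; elim=> [|k IHk] j jN.
  by rewrite addn0 -un // nth_nseq jN.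
rewrite addnS lu // big_seq big1 // => t tr; apply: IHk.
by have /(all_nthP [::])/(_ j jN)/allP := rows_lt; apply.
Qed.

Lemma shifts_eq0 (g : seq R) (s : nat -> R) :
  (forall n, shifts (rcons g 1) s n = 0) -> (forall k, (k < size g)%N -> s k = 0) ->
  forall n, s n = 0.
Proof.
move=> rec s0 n; elim/ltn_ind: n => n IHn.
have [/s0//|gn] := ltnP n (size g).
have := rec (n - size g)%N; rewrite /shifts size_rcons big_ord_recr /= big1 => [|k _].
  by rewrite nth_rcons ltnn eqxx mul1r add0r subnK.
rewrite IHn ?mulr0 // -[X in (_ < X)%N](subnK gn) ltn_add2l; exact: ltn_ord.
Qed.
End Linear.

(** [V] holds the counts at length 0, [V1] those at length 1, and [W] the defects of all states at
    length 1. The monic polynomial given by [gs] must annihilate [W]; then finitely many vanishing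
    defects of the start state, which has index 0, force all of them to vanish. *)
Definition recurrence_ok (R : comNzRingType) (rows : seq (seq nat)) (V : seq R)
    (cs gs vals : seq R) : bool :=
  let V1 := vnext rows V in
  let W := vcomb rows cs V1 in
  if vcomb rows (rcons gs 1) W == nseq (size rows) 0 then
    if [seq (iter k (vnext rows) W)`_0 | k <- iota 0 (size gs)] == nseq (size gs) 0 then
      [seq (iter k (vnext rows) V1)`_0 | k <- iota 0 (size vals)] == vals
    else false
  else false.

Definition certified (R : comNzRingType) (hs : seq word) (B : seq (seq nat)) (c : cert)
    (cs gs vals : seq R) : bool :=
  let T := table hs B c in
  if cert_ok B c T then
    recurrence_ok [seq e.2 | e <- c] [seq (eqn st.1 0)%:R | st <- T] cs gs vals
  else false.

Lemma certifiedP (R : comNzRingType) hs B c (cs gs vals : seq R) :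
  certified hs B c cs gs vals ->
  (forall n, shifts cs (fun n => (avoiders n (start B))%:R) n.+1 = 0) /\
  (forall k, (k < size vals)%N -> (avoiders k.+1 (start B))%:R = vals`_k).
Proof.
rewrite /certified /cert_ok; set T := table hs B c; set rows := map _ c.
case: ifP => //; case: ifP => // /equiv_avoiders startE; case: ifP => // lt_rows.
rewrite alllE; case: ifP => // /allP finT /rows_okP rowsE.
have sT : size T = size c by case: (rowsE 0%N).
have srows : size rows = size T by rewrite size_map.
have rows_lt : all (all (fun t => (t < size rows)%N)) rows.
  move: lt_rows; rewrite alllE srows all_map; apply: sub_all => e.
  by rewrite alllE => h; apply: sub_all h => t; rewrite lebE.
pose f n j : R := (avoiders n (nth st0 T j))%:R.
have linf : linear_system rows f.
  move=> n j; rewrite srows sT => jc; rewrite /f; have [_ /(_ _ jc) ->] := rowsE n.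
  by rewrite natr_sum.
have rep0 : represents rows [seq (eqn st.1 0)%:R | st <- T] (f 0%N).
  split=> [|j]; rewrite srows ?size_map // => jT.
  by rewrite (nth_map st0) // /f final_avoiders // finT // mem_nth.
rewrite /recurrence_ok; set V := map _ T in rep0 *.
case: ifP => // /eqP annE; case: ifP => // /eqP zeroE /eqP valsE.
have rep1 := vnext_represents rows_lt linf rep0.
have repk (u : nat -> nat -> R) W n k : linear_system rows u -> represents rows W (u n) ->
    represents rows (iter k (vnext rows) W) (u (n + k)%N).
  move=> lu rW; elim: k => [|k IHk]; first by rewrite addn0.
  by rewrite addnS; apply: vnext_represents.
have rows_gt0 : (0 < size rows)%N.
  rewrite srows /T /table; elim/last_ind: (behead c) => // cc e _.
  by rewrite -cats1 foldl_cat /= size_rcons.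
have f0E n : f n 0%N = (avoiders n (start B))%:R by rewrite /f startE.
pose h n j := shifts cs (f^~ j) n.
have linh : linear_system rows h by apply: linear_shifts.
have reph := vcomb_represents rows_lt cs linf rep1.
have repg := vcomb_represents rows_lt (rcons gs 1) linh reph.
have ling := linear_shifts (rcons gs 1) linh.
(* The combination of defects is zero in all states at length 1, hence at all later lengths. *)
have annh := linear_eq0 rows_lt ling; rewrite -/(vcomb _ _ _) annE in repg.
split=> [n|k kv].
  have -> : shifts cs (fun n => (avoiders n (start B))%:R) n.+1 = h n.+1 0%N.
    by apply: eq_bigr => k _; rewrite f0E.
  apply: (@shifts_eq0 _ gs (fun n => h n.+1 0%N)) => [m|k kg].
    rewrite -(annh _ repg m _ rows_gt0); apply: eq_bigr => k _.
    by rewrite !add1n addSn.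
  have [_ /(_ _ rows_gt0) <-] := repk h _ 1%N k linh reph.
  have := congr1 (fun s => s`_k) zeroE.
  by rewrite (nth_map 0%N) ?size_iota // nth_iota // nth_nseq kg.
have [_ /(_ _ rows_gt0)] := repk f _ 1%N k linf rep1.
rewrite f0E add1n => <-.
have := congr1 (fun s => s`_k) valsE.
by rewrite (nth_map 0%N) ?size_iota // nth_iota // => ->.
Qed.

(** The first list is the denominator in (3), from x^6 down to the constant term. The second one,
    completed by a leading 1, is X^3 (X - 1)^3 (X - 2); the factor X - 2 stems from the cycle
    through the states 2 and 5. The third one gives the counts for sizes 1 to 6. *)
Lemma mc_certified :
  certified hints (mc_patterns ++ hexagons) mc_cert
    ([:: - 3; 4; 8; - 14; 15; - 7; 1] : seq BinNums.Z)
    [:: 0; 0; 0; 2; - 7; 9; - 5] [:: 1; 2; 6; 21; 78; 298].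
Proof. by vm_compute. Qed.

(** Likewise for (2), with counts for sizes 1 to 7. Here the second list encodes X^3 (X - 1)^3 (X^2
    - X - 1), whose last factor is the Fibonacci recurrence of the states 2 and 5. *)
Lemma fb_certified :
  certified hints ([:: 4; 2; 3; 1]%N :: mc_patterns ++ hexagons) fb_cert
    ([:: 1; - 1; - 8; 1; 3; - 9; 6; - 1] : seq BinNums.Z)
    [:: 0; 0; 0; 1; - 2; - 1; 5; - 4] [:: 1; 2; 6; 20; 71; 260; 971].
Proof. by vm_compute. Qed.

(** * Generating functions *)

Definition fps_shift (k : nat) (f : fps rat) : fps rat := Fps (fun n => f (k + n)%N).

Lemma coef_fpsXM (f : fps rat) n : (fpsX * f) n.+1 = f n.
Proof. by have := coef_fpsXnM 1 f n.+1; rewrite expr1 subn1 => ->. Qed.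

Lemma coef_fps_natM k (f : fps rat) n : (k%:R * f) n = k%:R * f n.
Proof.
elim: k => [|k IHk]; first by rewrite !mul0r.
by rewrite -!natr1 !mulrDl coef_fpsD IHk !mul1r.
Qed.

Lemma fps_shiftE k (f : fps rat) a : f k = a%:R ->
  fps_shift k f = a%:R + fpsX * fps_shift k.+1 f.
Proof.
move=> fk; apply: fpsP => -[|n]; rewrite coef_fpsD -[a%:R]mulr1 coef_fps_natM coef_fps1.
  by rewrite coef0_fpsM mul0r addr0 mulr1 /= addn0.
by rewrite mulr0 add0r coef_fpsXM /= addnS.
Qed.

(** Certificates are evaluated over binary integers; the ring morphisms through [int] to [rat] carry
    the recurrence over. *)
Lemma rec_to_rat (cs : seq BinNums.Z) (u : nat -> nat) n :
  shifts cs (fun n => (u n)%:R) n = 0 ->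
  shifts (map (fun z => (int_of_Z z)%:~R) cs) (fun n => (u n)%:R : rat) n = 0.
Proof.
move=> /(congr1 (fun z => (int_of_Z z)%:~R : rat)) e.
apply: etrans (etrans e _); last by rewrite !rmorph0.
rewrite /shifts size_map !rmorph_sum /=; apply: eq_bigr => k _.
by rewrite (nth_map 0) // !rmorphM /= !rmorph_nat.
Qed.

Lemma natr_to_rat (u a : nat) : u%:R = a%:R :> BinNums.Z -> u%:R = a%:R :> rat.
Proof.
by move/(congr1 (fun z => (int_of_Z z)%:~R : rat)); rewrite /= !rmorph_nat.
Qed.

(** The factor [fpsX] lets the recurrence of the tree determine all coefficients, so the closed form
    only has to satisfy it. All sites with j > q lead to the same label (q, q), which is why the
    form is affine in m - q. *)
Lemma tree_eq (C G : fps rat) : C = 1 + fpsX * C ^+ 2 -> G * (2 - fpsX - C) = 1 ->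
  forall k m q, (0 < q <= m)%N -> (tree k m q)%:R =
    (G * (1 - C + C ^+ q + (m - q)%:R * (C ^+ q - C ^+ q.-1))) k.
Proof.
move=> CE GE; pose Phi m q := G * (1 - C + C ^+ q + (m - q)%:R * (C ^+ q - C ^+ q.-1)).
have XC2 : fpsX * C ^+ 2 = C - 1 by apply/esym/eqP; rewrite subr_eq addrC -CE.
have XC p : fpsX * C ^+ p.+2 = C ^+ p * (C - 1).
  by rewrite -XC2 -[p.+2]addn2 exprD; ring.
(* The sum telescopes: [fpsX] times a term is [C ^+ i.+1 - C ^+ i]. *)
have sum_pow p : fpsX * \sum_(i < p) C ^+ i.+2 = C ^+ p - 1.
  elim: p => [|p IHp]; first by rewrite big_ord0 mulr0 subrr.
  rewrite big_ord_recr /= mulrDr IHp.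
  by rewrite XC exprS; ring.
(* The children for j = i + 2, where q = p + 1 and m = p + d + 1: the first p of them have j at most
   q, the other d have label (q, q). *)
have sum_min p d : fpsX * \sum_(i < p + d) (1 - C + C ^+ minn i.+2 p.+1) =
    (p + d)%:R * fpsX * (1 - C) + C ^+ p - 1 + d%:R * fpsX * C ^+ p.+1.
  elim: d => [|d IHd].
    rewrite addn0 mul0r mul0r addr0 big_split /= mulrDr sumr_const card_ord.
    rewrite (eq_bigr (fun i : 'I_p => C ^+ i.+2)); last first.
      by move=> i _; rewrite (minn_idPl _) // ltnS ltn_ord.
    by rewrite sum_pow -mulr_natl; ring.
  rewrite addnS big_ord_recr /= mulrDr IHd (minn_idPr _); last by lia.
  by rewrite -!natr1; ring.
have rec m q : (0 < q <= m)%N ->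
    Phi m q = 1 + fpsX * \sum_(j < m.+1) Phi (child m q j).1 (child m q j).2.
  case: q => // p /= pm; have [d ->] : exists d, m = (p + d).+1.
    by exists (m.-1 - p)%N; move: pm; lia.
  rewrite 2!big_ord_recl /=.
  rewrite (eq_bigr (fun i : 'I_(p + d) => G * (1 - C + C ^+ minn i.+2 p.+1))); last first.
    by move=> i _; rewrite /bump /= !add1n /= /Phi subnn mul0r addr0.
  rewrite -mulr_sumr !mulrDr [fpsX * (G * \sum_(_ < _) _)]mulrCA sum_min /Phi !subSS subn0.
  rewrite (_ : p + d - p = d)%N; last by lia.
  (* Writing the summand 1 as G (2 - x - C) makes both sides multiples of [G]. *)
  rewrite -[X in _ = X + _]GE /= expr1 expr0 -natr1 natrD.
  apply/eqP; rewrite -subr_eq0; apply/eqP.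
  (* The difference of the two sides is a multiple of the quadratic relation for [C]. *)
  transitivity (- G * (1 + d%:R) * (fpsX * C ^+ p.+2 - C ^+ p * (C - 1))).
    by rewrite !exprS; ring.
  by rewrite XC subrr mulr0.
have child_ok m q j : (0 < q <= m)%N -> (j <= m)%N ->
    (0 < (child m q j).2 <= (child m q j).1)%N.
  by case: j => [|[|j]] /=; lia.
elim=> [|k IHk] m q qm; rewrite -/(Phi m q) rec // coef_fpsD coef_fps1.
  by rewrite coef0_fpsM mul0r addr0.
rewrite add0r coef_fpsXM /= natr_sum.
have coef_sum (I : finType) (F : I -> fps rat) n : (\sum_i F i) n = \sum_i F i n.
  by apply: (big_morph (fun f : fps rat => f n)).
rewrite coef_sum; apply: eq_bigr => j _; apply: IHk; apply: child_ok => //.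
by rewrite -ltnS.
Qed.

Lemma mc_series (F s : fps rat) :
  (forall n, F n = #|[set w : 'S_n.+1 | maximally_clustered w]|%:R) ->
  s 0%N = 1 -> s ^+ 2 = 1 - 4 * fpsX ->
  F * (- 1 + 4 * fpsX - 2 * fpsX ^+ 2 + s) = 2 * fpsX.
Proof.
move=> FE s0 s2.
(* The Catalan series, read off from s = 1 - 2xC. *)
pose C : fps rat := Fps (fun n => - s n.+1 / 2).
have sE : s = 1 - 2 * fpsX * C.
  apply: fpsP => -[|n]; rewrite coef_fpsB coef_fps1 -mulrA coef_fps_natM.
    by rewrite coef0_fpsM mul0r mulr0 subr0.
  rewrite coef_fpsXM /= sub0r mulrCA mulfV ?mulr1 ?opprK //.
have CE : C = 1 + fpsX * C ^+ 2.
  have h : 4 * fpsX * (1 + fpsX * C ^+ 2 - C) = 0 :> fps rat.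
    by apply/eqP; rewrite -(subrr (s ^+ 2)) {2}s2 sE; apply/eqP; ring.
  have X4 : 4 * fpsX != 0 :> fps rat.
    rewrite mulf_neq0 ?fpsX_neq0 //; apply/eqP => /(congr1 (fun f : fps rat => f 0%N)).
    by rewrite -[4]mulr1 coef_fps_natM.
  by move/eqP: h; rewrite mulf_eq0 (negPf X4) subr_eq0 => /eqP.
pose D := 2 - fpsX - C.
have D0 : D 0%N = 1.
  have C0 : C 0%N = 1 by rewrite CE coef_fpsD coef0_fpsM mul0r addr0.
  by rewrite /D !coef_fpsB C0 -[2]mulr1 coef_fps_natM.
have GE : D^-1 * D = 1 by rewrite mulVr // fps_unitE D0 unitr1.
have -> : F = D^-1.
  apply: fpsP => n; rewrite FE card_maximally_clustered (tree_eq CE GE) // subnn.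
  by congr (_ n); rewrite expr1 mul0r addr0 subrK mulr1.
(* In terms of [C], the denominator in (1) is [2 * fpsX * D]. *)
transitivity (2 * fpsX * (D^-1 * D)); last by rewrite GE mulr1.
by rewrite sE /D; ring.
Qed.

Lemma fps_shift0 (F : fps rat) : fps_shift 0 F = F.
Proof. exact: fpsP. Qed.

Lemma fps_shift_coef k (F : fps rat) n : fps_shift k F n = F (k + n)%N.
Proof. by []. Qed.

Lemma certified_series hs B c (cs gs vals : seq BinNums.Z) (rcs : seq rat) (F : fps rat) :
  certified hs B c cs gs vals -> map (fun z => (int_of_Z z)%:~R) cs = rcs ->
  (forall n, F n = #|[set w : 'S_n.+1 | avoids w B]|%:R) ->
  (forall n, \sum_(k < size rcs) rcs`_k * F (k + n)%N = 0) /\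
  (forall k a, (k < size vals)%N -> vals`_k = a%:R ->
     fps_shift k F = a%:R + fpsX * fps_shift k.+1 F).
Proof.
move=> /certifiedP[rec ini] <- FE; split=> [n|k a kv va].
  apply: etrans (rec_to_rat (rec n)); apply: eq_bigr => k _.
  by rewrite FE card_avoids addnC addSn.
apply: fps_shiftE; rewrite FE card_avoids; apply: natr_to_rat.
by rewrite ini.
Qed.

(** Once the first six terms of [F] are split off, the difference of the two sides is x^6 times the
    recurrence; the numerator merely encodes the six initial counts. *)
Lemma mc_hexagon_series (F : fps rat) :
  (forall n, F n = #|[set w : 'S_n.+1 | avoids w (mc_patterns ++ hexagons)]|%:R) ->
  F * (- 3 * fpsX ^+ 6 + 4 * fpsX ^+ 5 + 8 * fpsX ^+ 4 - 14 * fpsX ^+ 3 +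
       15 * fpsX ^+ 2 - 7 * fpsX + 1) =
  3 * fpsX ^+ 5 + fpsX ^+ 4 - 5 * fpsX ^+ 3 + 7 * fpsX ^+ 2 - 5 * fpsX + 1.
Proof.
have := @certified_series _ _ _ _ _ _ [:: - 3; 4; 8; - 14; 15; - 7; 1] F mc_certified.
move=> /[apply] -[|rec ini]; first by apply/eqP; vm_compute.
have F0 := ini 0%N 1%N isT erefl; have F1 := ini 1%N 2%N isT erefl.
have F2 := ini 2%N 6%N isT erefl; have F3 := ini 3%N 21%N isT erefl.
have F4 := ini 4%N 78%N isT erefl; have F5 := ini 5%N 298%N isT erefl.
have H : - (3 * fps_shift 0 F) + 4 * fps_shift 1 F + 8 * fps_shift 2 F
   - 14 * fps_shift 3 F + 15 * fps_shift 4 F - 7 * fps_shift 5 F + fps_shift 6 F = 0.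
  apply: fpsP => n; have recn := rec n; rewrite !big_ord_recr big_ord0 /= in recn.
  rewrite ?(coef_fpsD, coef_fpsN, coef_fps_natM, fps_shift_coef) -[RHS]recn.
  by ring.
rewrite -[F]fps_shift0; apply/eqP; rewrite -subr_eq0; apply/eqP.
transitivity (fpsX ^+ 6 * (- (3 * fps_shift 0 F) + 4 * fps_shift 1 F + 8 * fps_shift 2 F
   - 14 * fps_shift 3 F + 15 * fps_shift 4 F - 7 * fps_shift 5 F + fps_shift 6 F)); last by rewrite H mulr0.
by rewrite F0 F1 F2 F3 F4 F5; ring.
Qed.

Lemma fb_hexagon_series (F : fps rat) :
  (forall n, F n = #|[set w : 'S_n.+1 | avoids w ([:: 4; 2; 3; 1]%N :: mc_patterns ++ hexagons)]|%:R) ->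
  F * (fpsX ^+ 7 - fpsX ^+ 6 - 8 * fpsX ^+ 5 + fpsX ^+ 4 + 3 * fpsX ^+ 3 -
       9 * fpsX ^+ 2 + 6 * fpsX - 1) =
  - fpsX ^+ 6 - 2 * fpsX ^+ 5 + 2 * fpsX ^+ 4 + fpsX ^+ 3 - 3 * fpsX ^+ 2 +
    4 * fpsX - 1.
Proof.
have := @certified_series _ _ _ _ _ _ [:: 1; - 1; - 8; 1; 3; - 9; 6; - 1] F fb_certified.
move=> /[apply] -[|rec ini]; first by apply/eqP; vm_compute.
have F0 := ini 0%N 1%N isT erefl; have F1 := ini 1%N 2%N isT erefl.
have F2 := ini 2%N 6%N isT erefl; have F3 := ini 3%N 20%N isT erefl.
have F4 := ini 4%N 71%N isT erefl; have F5 := ini 5%N 260%N isT erefl.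
have F6 := ini 6%N 971%N isT erefl.
have H : fps_shift 0 F - fps_shift 1 F - 8 * fps_shift 2 F + fps_shift 3 F
   + 3 * fps_shift 4 F - 9 * fps_shift 5 F + 6 * fps_shift 6 F - fps_shift 7 F = 0.
  apply: fpsP => n; have recn := rec n; rewrite !big_ord_recr big_ord0 /= in recn.
  rewrite ?(coef_fpsD, coef_fpsN, coef_fps_natM, fps_shift_coef) -[RHS]recn.
  by ring.
rewrite -[F]fps_shift0; apply/eqP; rewrite -subr_eq0; apply/eqP.
transitivity (fpsX ^+ 7 * (fps_shift 0 F - fps_shift 1 F - 8 * fps_shift 2 F + fps_shift 3 F
   + 3 * fps_shift 4 F - 9 * fps_shift 5 F + 6 * fps_shift 6 F - fps_shift 7 F)); last by rewrite H mulr0.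
by rewrite F0 F1 F2 F3 F4 F5 F6; ring.
Qed.

(* Ring morphisms are pushed through these expressions over abstract rings, where
   unification is much faster than over Laurent series. *)
Section RingMorphism.
Variables (A B : comNzRingType) (phi : {rmorphism A -> B}) (x : A).

Let rmE := (rmorphD phi, rmorphN phi, rmorphM phi, rmorphXn phi, rmorph_nat phi, rmorph1 phi).

Lemma rmorph_mc_den (s : A) : phi (- 1 + 4 * x - 2 * x ^+ 2 + s) =
  - 1 + 4 * phi x - 2 * phi x ^+ 2 + phi s.
Proof. by rewrite !rmE. Qed.

Lemma rmorph_fb_num :
  phi (- x ^+ 6 - 2 * x ^+ 5 + 2 * x ^+ 4 + x ^+ 3 - 3 * x ^+ 2 + 4 * x - 1) =
  - phi x ^+ 6 - 2 * phi x ^+ 5 + 2 * phi x ^+ 4 + phi x ^+ 3 - 3 * phi x ^+ 2 +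
    4 * phi x - 1.
Proof. by rewrite !rmE. Qed.

Lemma rmorph_fb_den :
  phi (x ^+ 7 - x ^+ 6 - 8 * x ^+ 5 + x ^+ 4 + 3 * x ^+ 3 - 9 * x ^+ 2 + 6 * x - 1) =
  phi x ^+ 7 - phi x ^+ 6 - 8 * phi x ^+ 5 + phi x ^+ 4 + 3 * phi x ^+ 3 -
    9 * phi x ^+ 2 + 6 * phi x - 1.
Proof. by rewrite !rmE. Qed.

Lemma rmorph_mc_hexagon_num :
  phi (3 * x ^+ 5 + x ^+ 4 - 5 * x ^+ 3 + 7 * x ^+ 2 - 5 * x + 1) =
  3 * phi x ^+ 5 + phi x ^+ 4 - 5 * phi x ^+ 3 + 7 * phi x ^+ 2 - 5 * phi x + 1.
Proof. by rewrite !rmE. Qed.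

Lemma rmorph_mc_hexagon_den :
  phi (- 3 * x ^+ 6 + 4 * x ^+ 5 + 8 * x ^+ 4 - 14 * x ^+ 3 + 15 * x ^+ 2 - 7 * x + 1) =
  - 3 * phi x ^+ 6 + 4 * phi x ^+ 5 + 8 * phi x ^+ 4 - 14 * phi x ^+ 3 +
    15 * phi x ^+ 2 - 7 * phi x + 1.
Proof. by rewrite !rmE. Qed.
End RingMorphism.

Theorem mainTheorem4 :
  let x : laurent rat := fpsX%:L in
  let sqrt_1_4x : laurent rat := (fps_sqrt (1 - 4 * fpsX : fps rat))%:L in
  [/\ (Fps (fun n : nat =>
         #|[set w : 'S_n.+1 | maximally_clustered w]|%:R : rat))%:L
      = 2 * x / (-1 + 4 * x - 2 * x ^+ 2 + sqrt_1_4x),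
      (Fps (fun n : nat =>
         #|[set w : 'S_n.+1 | freely_braided w && hexagon_avoiding w]|%:R
         : rat))%:L
      = (- x ^+ 6 - 2 * x ^+ 5 + 2 * x ^+ 4 + x ^+ 3 - 3 * x ^+ 2 + 4 * x - 1)
        / (x ^+ 7 - x ^+ 6 - 8 * x ^+ 5 + x ^+ 4 + 3 * x ^+ 3 - 9 * x ^+ 2
           + 6 * x - 1)
    & (Fps (fun n : nat =>
         #|[set w : 'S_n.+1 | maximally_clustered w && hexagon_avoiding w]|%:R
         : rat))%:L
      = (3 * x ^+ 5 + x ^+ 4 - 5 * x ^+ 3 + 7 * x ^+ 2 - 5 * x + 1)
        / (- 3 * x ^+ 6 + 4 * x ^+ 5 + 8 * x ^+ 4 - 14 * x ^+ 3 + 15 * x ^+ 2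
           - 7 * x + 1)].
Proof.
move=> x sqrt_1_4x.
(* It suffices that the numerator is not zero, for a zero denominator would make it vanish. *)
have frac (f g h : fps rat) : g != 0 -> f * h = g -> f%:L = g%:L / h%:L.
  move=> g0 fh; rewrite -fh tofracM mulfK // tofrac_eq0.
  by apply: contraNneq g0 => h0; rewrite -fh h0 mulr0.
have neq0 (g w : fps rat) a : g = fpsX * w + a -> a 0%N != 0 -> g != 0.
  move=> ->; apply: contraNneq => /(congr1 (fun f : fps rat => f 0%N)).
  by rewrite coef_fpsD coef0_fpsM mul0r add0r => ->.
have [s0 s2] : fps_sqrt (1 - 4 * fpsX : fps rat) 0%N = 1 /\
    fps_sqrt (1 - 4 * fpsX : fps rat) ^+ 2 = 1 - 4 * fpsX.
  apply: fps_sqrtP; rewrite coef_fpsB coef_fps_natM coef_fps1 coef_fpsX.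
  by rewrite mulr0 subr0.
split; set F := Fps _.
- have e := @mc_series F _ (fun n => erefl) s0 s2.
  apply: etrans (frac _ _ _ _ e) _; last by rewrite rmorph_mc_den tofracM tofracMn tofrac1.
  (* The numerator is 2x, and its factor 2 has a nonzero constant term. *)
  by rewrite mulf_neq0 ?fpsX_neq0 //; apply: (neq0 _ 0 2); rewrite ?mulr0 ?add0r.
- have cardF n : F n = #|[set w : 'S_n.+1 | avoids w ([:: 4; 2; 3; 1]%N :: mc_patterns ++ hexagons)]|%:R.
    congr (_%:R); apply: eq_card => w; rewrite !in_set.
    by rewrite /freely_braided /hexagon_avoiding /avoids -all_cat.
  apply: etrans (frac _ _ _ _ (fb_hexagon_series cardF)) _.
    apply: (neq0 _ (- fpsX ^+ 5 - 2 * fpsX ^+ 4 + 2 * fpsX ^+ 3 + fpsX ^+ 2 - 3 * fpsX + 4) (- 1)) => //.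
    by ring.
  by rewrite rmorph_fb_num rmorph_fb_den.
- have cardF n : F n = #|[set w : 'S_n.+1 | avoids w (mc_patterns ++ hexagons)]|%:R.
    congr (_%:R); apply: eq_card => w; rewrite !in_set.
    by rewrite /maximally_clustered /hexagon_avoiding /avoids -all_cat.
  apply: etrans (frac _ _ _ _ (mc_hexagon_series cardF)) _.
    apply: (neq0 _ (3 * fpsX ^+ 4 + fpsX ^+ 3 - 5 * fpsX ^+ 2 + 7 * fpsX - 5) 1) => //.
    by ring.
  by rewrite rmorph_mc_hexagon_num rmorph_mc_hexagon_den.
Qed.
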